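(* Let $a,b>0$ with $a^2\neq b^2$ and consider the ellipsoid $\mathbb E_{a,a,a,b}\subset\mathbb R^4$ defined by $$\frac{x^2+y^2+z^2}{a^2}+\frac{w^2}{b^2}=1,$$ oriented by the inner unit normal. Then the umbilic set of $\mathbb E_{a,a,a,b}$ consists of the two points $(0,0,0,\pm b)$, and the partially umbilic set is the open set $\mathbb E_{a,a,a,b}\setminus\{(0,0,0,\pm b)\}$. One principal foliation is regular on $\mathbb E_{a,a,a,b}\setminus\{(0,0,0,\pm b)\}$, and it consists of the integral curves of the gradient (with respect to the induced metric) of the projection $(x,y,z,w)\mapsto w$. The distribution defined by the partially umbilic $2$-planes has as integral foliation the level spheres of this projection.
   Context: For a hypersurface of $\mathbb R^4$ with unit normal $N$, the principal curvatures $k_1\le k_2\le k_3$ at a point are the eigenvalues of $D(-N)$ acting on the tangent space; for ellipsoids $N$ is the inner unit normal. A point is umbilic if $k_1=k_2=k_3$, and partially umbilic if exactly two of the principal curvatures coincide. At a partially umbilic point, the partially umbilic $2$-plane is the two-dimensional eigenspace of the double principal curvature. A principal foliation is the foliation by integral curves (lines of curvature) of a one-dimensional eigenline field of $D(-N)$, where this line field is well defined. *)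

(* Defs.v *)
From HB Require Import structures.
From mathcomp Require Import all_boot all_order all_algebra.
From mathcomp Require Import all_classical all_reals all_analysis.
Set Implicit Arguments.
Unset Strict Implicit.
Unset Printing Implicit Defensive.
Import Order.TTheory GRing.Theory Num.Theory.
Import numFieldNormedType.Exports.
Local Open Scope classical_set_scope.
Local Open Scope ring_scope.

(* Points and vectors of R^4 are row vectors.  A linear subspace of R^4 is the
   row space of a matrix (scope %MS), and matrices act on the right. *)

Section Euclidean.
Context {R : realType}.
Implicit Types (f : 'rV[R]_4 -> R) (p u v : 'rV[R]_4).

(* The norm that the library puts on 'rV[R]_4 is the sup norm, hence [enorm]. *)
Definition dot u v : R := (u *m v^T) 0 0.
Definition enorm u : R := Num.sqrt (dot u u).

Definition gradient f p : 'rV[R]_4 := \row_(i < 4) 'D_(delta_mx 0 i) f p.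

End Euclidean.

(* [iter_derive [:: v1; ..; vn] g] is D_v1 (... (D_vn g)).  A map is of class
   C^oo on an open set V iff all of these are differentiable on V. *)
Section Smooth.
Context {R : realType} {n : nat} {W : normedModType R}.

Definition iter_derive (s : seq 'rV[R]_n) (g : 'rV[R]_n -> W) : 'rV[R]_n -> W :=
  foldr (fun v h => 'D_v h) g s.

Definition smooth_on (V : set 'rV[R]_n) (g : 'rV[R]_n -> W) : Prop :=
  forall s p, V p -> differentiable (iter_derive s g) p.

End Smooth.

Section Hypersurface.
Context {R : realType}.
Implicit Types (f h : 'rV[R]_4 -> R) (p v : 'rV[R]_4) (i : 'I_3).

(* All the notions below concern the hypersurface f = 1, at points where the
   gradient of f does not vanish. *)
Definition hypersurface f : set 'rV[R]_4 := [set p | f p = 1].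

Definition tangent f p : 'M[R]_4 := kermx (gradient f p)^T.

(* The unit normal pointing into the region f < 1; for an ellipsoid this is the
   inner one.  It is defined on a neighbourhood of the hypersurface, and its
   derivatives in tangent directions only depend on its values on the
   hypersurface. *)
Definition unit_normal f p : 'rV[R]_4 :=
  - (enorm (gradient f p))^-1 *: gradient f p.

(* D(-N) at p; only its restriction to the tangent space is meaningful. *)
Definition weingarten f p : 'M[R]_4 := 'J (fun q => - unit_normal f q) p.

(* k lists in nondecreasing order, with multiplicity, the eigenvalues of D(-N)
   acting on the tangent space. *)
Definition are_principal_curvatures f p (k : 'I_3 -> R) : Prop :=
  {homo k : i j / (i <= j)%N >-> i <= j} /\
  char_poly (restrictmx (tangent f p) (weingarten f p))
    = \prod_(i < 3) ('X - (k i)%:P).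

Definition principal_curvature f p : 'I_3 -> R :=
  xget (fun=> 0) [set k | are_principal_curvatures f p k].

Definition umbilic_set f : set 'rV[R]_4 :=
  [set p | hypersurface f p /\
    let k := principal_curvature f p in k 0 = k 1 /\ k 1 = k 2].

Definition partially_umbilic_set f : set 'rV[R]_4 :=
  [set p | hypersurface f p /\
    let k := principal_curvature f p in
    (k 0 = k 1 /\ k 1 != k 2) \/ (k 0 != k 1 /\ k 1 = k 2)].

Definition principal_space f p i : 'M[R]_4 :=
  (eigenspace (weingarten f p) (principal_curvature f p i) :&: tangent f p)%MS.

(* As the curvatures are sorted, a double one is always the middle one. *)
Definition partially_umbilic_plane f p : 'M[R]_4 := principal_space f p 1.

(* Gradient of the restriction of h to the hypersurface, for the induced
   metric. *)
Definition surface_gradient f h p : 'rV[R]_4 :=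
  xget 0 [set X | (X <= tangent f p)%MS /\
    forall v, (v <= tangent f p)%MS -> dot X v = 'd h p v].

End Hypersurface.

Section Foliations.
Context {R : realType}.
Implicit Types (U V S C : set 'rV[R]_4) (J : set R) (g : R -> 'rV[R]_4).
Implicit Types (X : 'rV[R]_4 -> 'rV[R]_4) (L D : 'rV[R]_4 -> 'M[R]_4).

Definition open_interval J : Prop := [/\ open J, is_interval J & J !=set0].

Definition integral_curve U X J g : Prop :=
  open_interval J /\
  forall t, J t -> U (g t) /\ is_derive t (1 : R) g (X (g t)).

Definition maximal_integral_curve U X J g : Prop :=
  integral_curve U X J g /\
  forall J' g', integral_curve U X J' g' -> J `<=` J' ->
    (forall t, J t -> g' t = g t) -> J' = J.

(* Regular C^1 curves in U tangent to the field of lines L. *)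
Definition line_field_curve U L J g : Prop :=
  open_interval J /\
  forall t, J t -> [/\ U (g t), derivable g t (1 : R),
    {for t, continuous (derive1 g)}, derive1 g t != 0 &
    (derive1 g t <= L (g t))%MS].

(* The leaves of the foliation by integral curves of L: since L has no preferred
   parametrisation, maximality is that of traces, for inclusion. *)
Definition line_field_leaf U L C : Prop :=
  (exists J g, line_field_curve U L J g /\ C = g @` J) /\
  forall J g, line_field_curve U L J g -> C `<=` g @` J -> C = g @` J.

(* L is a smooth field of lines (without singularities) on U. *)
Definition regular_line_field U L : Prop :=
  forall p, U p -> exists V X, [/\ open V, V p, smooth_on V X &
    forall q, V q -> U q -> X q != 0 /\ (L q == X q)%MS].

(* The set where the line field of the i-th principal curvature is defined. *)
Definition principal_domain (f : 'rV[R]_4 -> R) (i : 'I_3) : set 'rV[R]_4 :=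
  [set p | hypersurface f p /\ forall j, j != i ->
    principal_curvature f p j != principal_curvature f p i].

Definition principal_foliation (f : 'rV[R]_4 -> R) (i : 'I_3) :
    set (set 'rV[R]_4) :=
  [set C | line_field_leaf (principal_domain f i)
             (fun p => principal_space f p i) C].

Definition principal_foliation_regular (f : 'rV[R]_4 -> R) (i : 'I_3) U : Prop :=
  U `<=` principal_domain f i /\
  regular_line_field U (fun p => principal_space f p i).

(* S is an embedded surface of R^4 with tangent plane D q at each of its points
   q: locally, it is the zero set of a submersion. *)
Definition integral_surface D S : Prop :=
  forall p, S p -> exists V (h : 'rV[R]_4 -> 'rV[R]_2),
    [/\ open V, V p, smooth_on V h,
      forall q, V q -> (S q <-> h q = 0) &
      forall q, V q -> S q -> \rank ('J h q) = 2 /\ (kermx ('J h q) == D q)%MS].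

(* A partition of U into connected integral surfaces of D.  For a smooth D there
   is at most one: any connected integral surface in U meeting a member is
   contained in it, so that the members are the maximal ones, i.e. the leaves. *)
Definition integral_foliation U D (F : set (set 'rV[R]_4)) : Prop :=
  partition F id U /\ forall S, F S -> connected S /\ integral_surface D S.

End Foliations.

Section Ellipsoid.
Context {R : realType}.

Definition ellipsoid_fun (a b : R) (p : 'rV[R]_4) : R :=
  (p 0 0 ^+ 2 + p 0 1 ^+ 2 + p 0 2 ^+ 2) / a ^+ 2 + p 0 3 ^+ 2 / b ^+ 2.

Definition ellipsoid (a b : R) : set 'rV[R]_4 := hypersurface (ellipsoid_fun a b).

Definition proj_w (p : 'rV[R]_4) : R := p 0 3.

Definition on_w_axis (c : R) : 'rV[R]_4 := c *: delta_mx 0 3.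

Definition poles (b : R) : set 'rV[R]_4 := [set on_w_axis b; on_w_axis (- b)].

Definition level_set (a b c : R) : set 'rV[R]_4 :=
  ellipsoid a b `&` [set p | proj_w p = c].

Definition is_sphere (c : R) (S : set 'rV[R]_4) : Prop :=
  exists2 r : R, 0 < r &
    S = [set p | proj_w p = c /\ enorm (p - on_w_axis c) = r].

End Ellipsoid.

(* Main.v *)
Require Import Defs.
From HB Require Import structures.
From mathcomp Require Import all_boot all_order all_algebra.
From mathcomp Require Import all_classical all_reals all_analysis.
From mathcomp Require Import ring lra.
Import Order.TTheory GRing.Theory Num.Theory.
Import numFieldNormedType.Exports.
Local Open Scope classical_set_scope.
Local Open Scope ring_scope.
Set Implicit Arguments.
Unset Strict Implicit.
Unset Printing Implicit Defensive.

(** Write a point of R^4 as (x, w) with x in R^3, and let nu = (x / a^2, w / b^2),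
    half the gradient of the equation, and phi = |nu|.  Then -N = nu / phi, and
    differentiating gives the shape operator on tangent vectors
      v |-> nu(v) / phi - <nu, nu(v)> nu / phi^3   ([mulmx_weingarten]).
    Off the poles the tangent space is the orthogonal sum of two eigenspaces: the
    plane of the horizontal tangent vectors, those with zero last coordinate, with
    eigenvalue 1 / (a^2 phi), and the line of e = (- (w / b^2) x, |x|^2 / a^2),
    tangent to the meridian, with eigenvalue 1 / (a^2 b^2 phi^3).  The difference
    of the eigenvalues is |x|^2 (a^2 - b^2) / (a^6 b^2 phi^3) ([curvature_gap]).
    As a^2 <> b^2, it vanishes only for x = 0, that is at the poles, and its sign
    is constant: the simple curvature is the largest one if b < a, and the smallest
    one if a < b.  This settles the umbilic and partially umbilic sets, and shows
    that the regular principal line field is spanned by the polynomial vector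
    field e.

    The gradient of w on the ellipsoid is e / (a^2 phi^2), a positive multiple of
    e ([surface_gradientE]).  Along any curve tangent to e the direction x / |x| is
    constant ([direction_constant]), so that the curve stays in a half-ellipse
    which joins the poles, a meridian.  With hyperbolic functions a meridian is
      s |-> (a u / cosh s, b tanh s),   |u| = 1,
    which is a regular curve tangent to e.  Hence the leaves of the principal
    foliation are the full meridians ([line_field_leafP]).  In the parameter s,
    the time of the gradient flow is (b - a^2 / b) tanh s + (a^2 / b) s, an
    increasing bijection of the real line.  So the gradient flow is complete off
    the poles, and the traces of its maximal integral curves are also the full
    meridians ([gradient_curveP]).

    The level set w = c is the sphere |x|^2 = a^2 (1 - c^2 / b^2).  It is the zero
    set of (f - 1, w - c), where f is the equation; the kernel of the differential
    of this map is the horizontal tangent plane.  It is connected because it is a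
    union of circles through one of its points. *)

(** * Restriction of an endomorphism to a sum of two eigenspaces *)

Section LinearAlgebra.
Context {F : fieldType}.

Lemma char_poly_similar n (P D : 'M[F]_n) : P \in unitmx ->
  char_poly (P *m D *m invmx P) = char_poly D.
Proof.
move=> Pu; pose c := map_mx (@polyC F).
have PPV : c n n P *m c n n (invmx P) = 1%:M by rewrite -map_mxM mulmxV// map_mx1.
rewrite /char_poly (_ : char_poly_mx _ = c n n P *m char_poly_mx D *m c n n (invmx P)).
  by rewrite !det_mulmx mulrAC -det_mulmx PPV det1 mul1r.
rewrite /char_poly_mx mulmxBr mulmxBl -!map_mxM; congr (_ - _).
by rewrite scalar_mxC -mulmxA PPV mulmx1.
Qed.

(** [restrictmx] computes in the basis [row_base V], whose size is the rank of
    [V]; the lemma allows any other basis [B], with a size known by other means. *)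
Lemma char_poly_restrictmx m n r (V : 'M[F]_(r, n)) (A : 'M[F]_n)
    (B : 'M[F]_(m, n)) (D : 'M[F]_m) :
  row_free B -> (B :=: V)%MS -> B *m A = D *m B ->
  char_poly (restrictmx V A) = char_poly D.
Proof.
move=> fB BV BA.
have BB' : (B :=: row_base V)%MS by apply: eqmx_trans BV (eqmx_sym (eq_row_base V)).
move: BB' (row_base_free V); move: (\rank V) (row_base V) => m' B' BB' fB'.
have mm' : m = m'.
  by rewrite -(eqP fB) -(eqP fB') BB'.
subst m'.
pose P := B' *m pinvmx B; pose Q := B *m pinvmx B'.
have PB : P *m B = B' by rewrite mulmxKpV// BB'.
have QB : Q *m B' = B by rewrite mulmxKpV// BB'.
have PQ : P *m Q = 1%:M.
  by apply: (row_free_inj fB'); rewrite -mulmxA QB PB mul1mx.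
have [Pu _] := mulmx1_unit PQ.
rewrite -(char_poly_similar D Pu); congr char_poly.
have -> : invmx P = Q by rewrite -[Q]mul1mx -(mulVmx Pu) -mulmxA PQ mulmx1.
rewrite /conjmx -[X in X *m A]PB -(mulmxA P B) BA mulmxA -(mulmxA _ B).
by rewrite /Q.
Qed.

Variables (n r : nat) (V : 'M[F]_(r, n)) (A P Q : 'M[F]_n) (alpha beta : F).
Hypotheses (PQV : (P + Q :=: V)%MS) (PQ0 : (P :&: Q)%MS = 0)
  (PA : (P <= eigenspace A alpha)%MS) (QA : (Q <= eigenspace A beta)%MS).

Lemma char_poly_two_eigenspaces : char_poly (restrictmx V A) =
  ('X - alpha%:P) ^+ \rank P * ('X - beta%:P) ^+ \rank Q.
Proof.
pose d : 'rV[F]_(\rank P + \rank Q) := row_mx (const_mx alpha) (const_mx beta).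
have dl k : d 0 (lshift _ k) = alpha by rewrite row_mxEl mxE.
have dr k : d 0 (rshift _ k) = beta by rewrite row_mxEr mxE.
clearbody d.
rewrite (@char_poly_restrictmx _ _ _ V A (col_mx (row_base P) (row_base Q)) (diag_mx d)).
- rewrite char_poly_trig ?diag_mx_is_trig// big_split_ord/=; congr (_ * _).
    under eq_bigr do rewrite mxE eqxx dl mulr1n.
    by rewrite prodr_const card_ord.
  under eq_bigr do rewrite mxE eqxx dr mulr1n.
  by rewrite prodr_const card_ord.
- rewrite /row_free -addsmxE -(adds_eqmx (eqmx_sym (eq_row_base P)) (eqmx_sym (eq_row_base Q))).
  by apply/eqP; rewrite mxrank_disjoint_sum.
- apply: eqmx_trans PQV; apply: eqmx_trans (eqmx_sym (addsmxE _ _)) _.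
  exact: adds_eqmx (eq_row_base _) (eq_row_base _).
- have -> : diag_mx d = block_mx alpha%:M 0 0 beta%:M.
    apply/matrixP => i j; case: (split_ordP i) => k ->; case: (split_ordP j) => l ->;
      rewrite ?block_mxEul ?block_mxEur ?block_mxEdl ?block_mxEdr mxE
        ?dl ?dr ?mxE ?eq_shift ?mulr0n ?mulrb //.
  have /eigenspaceP PA' : (row_base P <= eigenspace A alpha)%MS by rewrite eq_row_base.
  have /eigenspaceP QA' : (row_base Q <= eigenspace A beta)%MS by rewrite eq_row_base.
  by rewrite mul_col_mx PA' QA' mul_block_col !mul_scalar_mx !mul0mx addr0 add0r.
Qed.

(** Write v in V as p + q along P and Q: if A v = alpha v then
    (beta - alpha) q = 0, so that v = p. *)
Lemma eigenspace_cap_first : alpha != beta -> (eigenspace A alpha :&: V :=: P)%MS.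
Proof.
move=> ab; apply/eqmxP/andP; split; last first.
  by rewrite sub_capmx PA -PQV addsmxSl.
apply/row_subP => i; set v := row i _.
have : (v <= eigenspace A alpha :&: V)%MS by rewrite row_sub.
rewrite sub_capmx -PQV => /andP[/eigenspaceP vA /sub_addsmxP[[c1 c2] /= vE]].
have /eigenspaceP pA : (c1 *m P <= eigenspace A alpha)%MS by rewrite mulmx_sub.
have /eigenspaceP qA : (c2 *m Q <= eigenspace A beta)%MS by rewrite mulmx_sub.
have : (beta - alpha) *: (c2 *m Q) = 0.
  have := vA; rewrite vE mulmxDl pA qA scalerDr => /addrI.
  by move=> H; rewrite scalerBl H subrr.
move/eqP; rewrite scaler_eq0 subr_eq0 eq_sym (negbTE ab) => /eqP q0.
by rewrite vE q0 addr0 submxMl.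
Qed.

End LinearAlgebra.

Lemma eigenspace_cap_second {F : fieldType} n r
    (V : 'M[F]_(r, n)) (A P Q : 'M[F]_n) (alpha beta : F) :
  (P + Q :=: V)%MS -> (P <= eigenspace A alpha)%MS -> (Q <= eigenspace A beta)%MS ->
  alpha != beta -> (eigenspace A beta :&: V :=: Q)%MS.
Proof.
move=> PQV PA QA ab; apply: eigenspace_cap_first PA _ => //; last by rewrite eq_sym.
by apply: eqmx_trans PQV; rewrite addsmxC.
Qed.

(** * Derivatives of vector-valued maps, and smoothness of polynomial maps *)

Section Calculus.
Context {R : realType}.

Lemma differentiable_row (V : normedModType R) n (F : V -> 'rV[R]_n) p :
  (forall i, differentiable (fun q => F q 0 i : R) p) -> differentiable F p.
Proof.
move=> dF; have -> : F = \sum_(i < n) (fun q => F q 0 i *: delta_mx 0 i).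
  by apply/funext => q; rewrite fct_sumE; exact: row_sum_delta.
apply: differentiable_sum => i; exact: differentiableZl.
Qed.

Lemma is_derive_row (V : normedModType R) n (F : V -> 'rV[R]_n) (dF : 'rV[R]_n) p v :
  (forall i, is_derive p v (fun q => F q 0 i : R) (dF 0 i)) -> is_derive p v F dF.
Proof.
move=> H; have dF' : derivable F p v.
  by apply/derivable_mxP => i j; rewrite ord1; apply: ex_derive.
apply: DeriveDef => //; rewrite derive_mx//.
apply/rowP => i; rewrite mxE; exact: derive_val.
Qed.

Lemma is_derive_row_coord (V : normedModType R) n (F : V -> 'rV[R]_n) (dF : 'rV[R]_n) p v i :
  is_derive p v F dF -> is_derive p v (fun q => F q 0 i : R) (dF 0 i).
Proof.
move=> [dF' <-]; rewrite derive_mx//.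
rewrite mxE; exact/derivableP/(iffLR (derivable_mxP _ _ _) dF').
Qed.

Global Instance is_derive_coord n (p v : 'rV[R]_n) i :
  is_derive p v (fun q : 'rV[R]_n => q 0 i : R) (v 0 i).
Proof. exact: (is_derive_row_coord (F := id) i (is_derive_id p v)). Qed.

Lemma is_derive_chain (V : normedModType R) (f : R -> R) (g : V -> R) (p v : V) a :
  differentiable g p -> is_derive (g p) 1 f a ->
  is_derive p v (f \o g) (a * 'D_v g p).
Proof.
move=> dg df; have df' : differentiable f (g p) by apply/derivable1_diffP/ex_derive.
have d : differentiable (f \o g) p by apply: differentiable_comp.
apply: DeriveDef; first exact: diff_derivable.
rewrite deriveE// diff_comp//= deriv1E; last exact: ex_derive.
by rewrite derive1E derive_val -deriveE//= mulrC.
Qed.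

(** Derivatives are computed below as terms built from the lemmas on sums and
    products; this lemma restates them in the form that is needed. *)
Lemma is_derive_ext (V W : normedModType R) (g h : V -> W) (p v : V) d d' :
  is_derive p v g d -> g =1 h -> d = d' -> is_derive p v h d'.
Proof. by move=> dg /funext <- <-. Qed.

Lemma is_derive_sq (V : normedModType R) (g : V -> R) (p v : V) d :
  is_derive p v g d -> is_derive p v (fun q => g q ^+ 2) (2 * g p * d).
Proof.
move=> dg; apply: (is_derive_ext (is_deriveM dg dg)) => [q|]; first by rewrite expr2.
rewrite /GRing.scale /=; ring.
Qed.

Lemma is_derive_inv (V : normedModType R) (g : V -> R) (p v : V) d :
  g p != 0 -> is_derive p v g d ->
  is_derive p v (fun q => (g q)^-1) (- (g p) ^- 2 * d).
Proof.
move=> g0 [dg <-]; apply: DeriveDef; first exact: derivableV.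
by rewrite deriveV.
Qed.

Lemma mulmx_jacobian m n (F : 'rV[R]_m -> 'rV[R]_n) p v :
  differentiable F p -> v *m 'J F p = 'D_v F p.
Proof. by move=> dF; rewrite deriveEjacobian. Qed.

(** The class is closed under directional derivatives and its members are
    differentiable: smoothness of polynomial maps follows without any formula for
    the iterated derivatives. *)
Inductive polynomial_fun n : ('rV[R]_n -> R) -> Prop :=
| polynomial_cst c : polynomial_fun (fun=> c)
| polynomial_coord i : polynomial_fun (fun q => q 0 i)
| polynomial_add f g : polynomial_fun f -> polynomial_fun g ->
    polynomial_fun (fun q => f q + g q)
| polynomial_mul f g : polynomial_fun f -> polynomial_fun g ->
    polynomial_fun (fun q => f q * g q).

Lemma polynomial_differentiable n (f : 'rV[R]_n -> R) p :
  polynomial_fun f -> differentiable f p.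
Proof.
elim=> [c|i|g h _ dg _ dh|g h _ dg _ dh].
- exact: differentiable_cst.
- exact: differentiable_coord.
- exact: differentiableD.
- exact: differentiableM.
Qed.

Lemma polynomial_derive n (f : 'rV[R]_n -> R) v :
  polynomial_fun f -> polynomial_fun (fun p => 'D_v f p).
Proof.
elim=> [c|i|g h pg dg ph dh|g h pg dg ph dh].
- rewrite [X in polynomial_fun X](_ : _ = fun=> 0); first exact: polynomial_cst.
  by apply/funext => p; rewrite derive_cst.
- rewrite [X in polynomial_fun X](_ : _ = fun=> v 0 i); first exact: polynomial_cst.
  by apply/funext => p; rewrite derive_val.
- rewrite [X in polynomial_fun X](_ : _ = fun p => 'D_v g p + 'D_v h p).
    exact: polynomial_add.
  apply/funext => p; rewrite (deriveD (f := g) (g := h))//;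
    exact/diff_derivable/polynomial_differentiable.
- rewrite [X in polynomial_fun X](_ : _ = fun p => g p * 'D_v h p + h p * 'D_v g p).
    by apply: polynomial_add; apply: polynomial_mul.
  apply/funext => p; rewrite (deriveM (f := g) (g := h))//;
    exact/diff_derivable/polynomial_differentiable.
Qed.

Lemma polynomial_smooth m n (F : 'rV[R]_m -> 'rV[R]_n) (V : set 'rV[R]_m) :
  (forall i, polynomial_fun (fun q => F q 0 i)) -> smooth_on V F.
Proof.
move=> pF s p _; suff pD i : polynomial_fun (fun q => iter_derive s F q 0 i).
  by apply: differentiable_row => i; exact: polynomial_differentiable.
elim: s i => [|v s IH] i //=.
rewrite [X in polynomial_fun X](_ : _ = fun q => 'D_v (fun r => iter_derive s F r 0 i) q).
  exact: polynomial_derive.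
apply/funext => q; rewrite derive_mx ?mxE//.
apply/diff_derivable/differentiable_row => j; exact: polynomial_differentiable.
Qed.

Lemma polynomial_opp n (f : 'rV[R]_n -> R) :
  polynomial_fun f -> polynomial_fun (fun q => - f q).
Proof.
move=> pf; rewrite [X in polynomial_fun X](_ : _ = fun q => -1 * f q).
  by apply: polynomial_mul => //; exact: polynomial_cst.
by apply/funext => q; rewrite mulN1r.
Qed.

Lemma polynomial_exp n (f : 'rV[R]_n -> R) k :
  polynomial_fun f -> polynomial_fun (fun q => f q ^+ k).
Proof.
move=> pf; elim: k => [|k IH]; first exact: polynomial_cst.
by under eq_fun do rewrite exprS; exact: polynomial_mul.
Qed.

End Calculus.

(** * Coordinates in R^4 *)

Section Coordinates.
Context {R : realType}.
Implicit Types u v p : 'rV[R]_4.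

Lemma ord4P (P : 'I_4 -> Prop) : P 0 -> P 1 -> P 2 -> P 3 -> forall i, P i.
Proof.
move=> P0 P1 P2 P3 [[|[|[|[|i]]]] Hi] //.
- by rewrite (_ : Ordinal Hi = 0)//; exact: val_inj.
- by rewrite (_ : Ordinal Hi = 1)//; exact: val_inj.
- by rewrite (_ : Ordinal Hi = 2)//; exact: val_inj.
- by rewrite (_ : Ordinal Hi = 3)//; exact: val_inj.
Qed.

Lemma sum4E (V : nmodType) (F : 'I_4 -> V) : \sum_i F i = F 0 + F 1 + F 2 + F 3.
Proof.
rewrite !big_ord_recl big_ord0 addr0 !addrA.
by do 3?congr (_ + _); congr F; apply: val_inj.
Qed.

Lemma row4P u v :
  u 0 0 = v 0 0 -> u 0 1 = v 0 1 -> u 0 2 = v 0 2 -> u 0 3 = v 0 3 -> u = v.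
Proof. by move=> *; apply/rowP; exact: ord4P. Qed.

Lemma dotE u v :
  dot u v = u 0 0 * v 0 0 + u 0 1 * v 0 1 + u 0 2 * v 0 2 + u 0 3 * v 0 3.
Proof. by rewrite /dot mxE sum4E !mxE. Qed.

Lemma dotuu_ge0 u : 0 <= dot u u.
Proof. by rewrite dotE; nra. Qed.

Lemma dotuu_eq0 u : (dot u u == 0) = (u == 0).
Proof.
apply/eqP/eqP => [|->]; last by rewrite dotE !mxE; ring.
rewrite dotE => h; apply: row4P; rewrite !mxE; nra.
Qed.

End Coordinates.

(** * The shape operator of the ellipsoid *)

Section Shape.
Context {R : realType} (a b : R).
Hypotheses (a0 : 0 < a) (b0 : 0 < b).
Implicit Types p q u v : 'rV[R]_4.
Local Notation f := (ellipsoid_fun a b).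

(** Half the gradient of [f] at [p]; being linear in [p], it is its own derivative. *)
Definition conormal p : 'rV[R]_4 :=
  \row_i (p 0 i / (if i == 3 then b ^+ 2 else a ^+ 2)).

Lemma conormalE p : ((conormal p 0 0 = p 0 0 / a ^+ 2) * (conormal p 0 1 = p 0 1 / a ^+ 2) *
  (conormal p 0 2 = p 0 2 / a ^+ 2) * (conormal p 0 3 = p 0 3 / b ^+ 2))%type.
Proof. by rewrite !mxE. Qed.

Lemma polynomial_ellipsoid_fun : polynomial_fun f.
Proof.
rewrite /ellipsoid_fun.
by do ?[apply: polynomial_add|apply: polynomial_mul|apply: polynomial_exp];
  first [exact: polynomial_coord|exact: polynomial_cst].
Qed.

Lemma is_derive_ellipsoid_fun p v : is_derive p v f (2 * dot (conormal p) v).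
Proof.
have dsq i := is_derive_sq (is_derive_coord p v i).
have d012 := is_deriveD (is_deriveD (dsq 0) (dsq 1)) (dsq 2).
have d := is_deriveD (is_deriveZ (a ^- 2) d012) (is_deriveZ (b ^- 2) (dsq 3)).
apply: (is_derive_ext d) => [q|].
  by rewrite /ellipsoid_fun mulrC [X in _ = _ + X]mulrC.
rewrite dotE !conormalE /GRing.scale /=; ring.
Qed.

Lemma gradient_ellipsoid_fun p : gradient f p = 2 *: conormal p.
Proof.
apply/rowP => i; rewrite [LHS]mxE [RHS]mxE.
have [_ ->] := is_derive_ellipsoid_fun p (delta_mx 0 i); congr (2 * _).
by move: i; apply: ord4P; rewrite dotE !conormalE !mxE /=; ring.
Qed.

(** Euler's identity for the quadratic form [f].  It shows that the gradient does
    not vanish on the ellipsoid. *)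
Lemma dot_conormal p : dot (conormal p) p = f p.
Proof. rewrite dotE !conormalE /ellipsoid_fun; ring. Qed.

Definition normal_length p : R := enorm (conormal p).
Local Notation phi := normal_length.

Lemma normal_length_sq p : phi p ^+ 2 = dot (conormal p) (conormal p).
Proof. by rewrite sqr_sqrtr// dotuu_ge0. Qed.

Lemma conormal_neq0 p : f p = 1 -> conormal p != 0.
Proof.
move=> fp; apply/eqP => n0; have := dot_conormal p.
by rewrite n0 fp /dot mul0mx mxE => /eqP; rewrite eq_sym oner_eq0.
Qed.

Lemma normal_length_gt0 p : f p = 1 -> 0 < phi p.
Proof. by move=> fp; rewrite sqrtr_gt0 lt_neqAle dotuu_ge0 eq_sym dotuu_eq0 conormal_neq0. Qed.

Lemma unit_normalE : (fun q => - unit_normal f q) = (fun q => (phi q)^-1 *: conormal q).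
Proof.
apply/funext => q; rewrite /unit_normal gradient_ellipsoid_fun scaleNr opprK scalerA.
rewrite /phi /enorm; set u := conormal q; congr (_ *: _).
have -> : dot (2 *: u) (2 *: u) = 2 ^+ 2 * dot u u by rewrite !dotE !mxE; ring.
rewrite sqrtrM ?exprn_ge0// sqrtr_sqr ger0_norm// invfM.
by rewrite mulrAC mulVf ?mul1r// pnatr_eq0.
Qed.

Let polynomial_conormal i : polynomial_fun (fun q => conormal q 0 i).
Proof.
under eq_fun do rewrite mxE.
by apply: polynomial_mul; [exact: polynomial_coord|exact: polynomial_cst].
Qed.

Let polynomial_sqnorm : polynomial_fun (fun q => dot (conormal q) (conormal q)).
Proof. by under eq_fun do rewrite dotE; do ?apply: polynomial_add; apply: polynomial_mul. Qed.

Let derive_conormal p v i : is_derive p v (fun q => conormal q 0 i) (conormal v 0 i).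
Proof.
pose c := (if i == 3 then b ^+ 2 else a ^+ 2)^-1.
rewrite (_ : (fun _ => _) = c *: (fun q : 'rV[R]_4 => q 0 i)).
  by rewrite mxE -/c mulrC; exact: is_deriveZ.
by apply/funext => q; rewrite mxE mulrC.
Qed.

Let derive_sqnorm p v :
  'D_v (fun q => dot (conormal q) (conormal q)) p = 2 * dot (conormal p) (conormal v).
Proof.
have dsq i := is_derive_sq (derive_conormal p v i).
have d := is_deriveD (is_deriveD (is_deriveD (dsq 0) (dsq 1)) (dsq 2)) (dsq 3).
apply: derive_val; apply: (is_derive_ext d) => [q|]; first by rewrite dotE -!expr2.
rewrite dotE; ring.
Qed.

(** The map -N is [conormal / phi] near the ellipsoid, and the derivative of
    [phi], the square root of [dot conormal conormal], in the direction [v] is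
    [dot (conormal p) (conormal v) / phi p]. *)
Lemma mulmx_weingarten p v : f p = 1 ->
  v *m weingarten f p = (phi p)^-1 *: conormal v
    - (dot (conormal p) (conormal v) / phi p ^+ 3) *: conormal p.
Proof.
move=> fp; have phi0 := normal_length_gt0 fp.
have sq0 : 0 < dot (conormal p) (conormal p).
  by rewrite lt_neqAle dotuu_ge0 eq_sym dotuu_eq0 conormal_neq0.
have dphi w : is_derive p w phi (dot (conormal p) (conormal w) / phi p).
  have d := is_derive_chain w (polynomial_differentiable p polynomial_sqnorm) (is_derive1_sqrt sq0).
  apply: (is_derive_ext d) => //; rewrite derive_sqnorm.
  by rewrite /phi /enorm invfM mulrACA mulVf ?mul1r 1?mulrC// pnatr_eq0.
have diffphi : differentiable phi p.
  rewrite (_ : phi = Num.sqrt \o (fun q => dot (conormal q) (conormal q)))//.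
  apply: differentiable_comp; first exact: polynomial_differentiable.
  exact/derivable1_diffP/ex_derive/is_derive1_sqrt.
rewrite /weingarten unit_normalE mulmx_jacobian; last first.
  apply: differentiable_row => i; under eq_fun do rewrite mxE.
  apply: differentiableM; last exact: polynomial_differentiable.
  by apply: differentiableV => //; rewrite gt_eqF.
apply: derive_val; apply: is_derive_row => i.
under eq_fun do rewrite mxE.
have d := is_deriveM (is_derive_inv (lt0r_neq0 phi0) (dphi v)) (derive_conormal p v i).
apply: (is_derive_ext d) => //; rewrite !mxE /GRing.scale /=.
by field; rewrite (gt_eqF phi0) andbT; case: ifP => _; rewrite gt_eqF ?exprn_gt0.
Qed.

End Shape.

(** * Principal curvatures and principal directions *)

Section Curvatures.
Context {R : realType} (a b : R).
Hypotheses (a0 : 0 < a) (b0 : 0 < b).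
Implicit Types p q u v : 'rV[R]_4.
Local Notation f := (ellipsoid_fun a b).
Local Notation nu := (conormal a b).
Local Notation phi := (normal_length a b).

(** The square of the distance to the w-axis, that is of the radius of the
    parallel through [p]. *)
Definition parallel_sq p : R := p 0 0 ^+ 2 + p 0 1 ^+ 2 + p 0 2 ^+ 2.

(** Tangent at [p] to the meridian through [p], the half-ellipse with a constant
    direction of (x, y, z).  This scaling is polynomial in [p]. *)
Definition meridian p : 'rV[R]_4 :=
  \row_i (if i == 3 then parallel_sq p / a ^+ 2 else - (p 0 i * p 0 3 / b ^+ 2)).

Definition horizontal p : 'M[R]_4 :=
  kermx (row_mx (gradient f p)^T (delta_mx 0 3 : 'rV[R]_4)^T).

Definition parallel_curvature p : R := (a ^+ 2 * phi p)^-1.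
Definition meridian_curvature p : R := (a ^+ 2 * b ^+ 2 * phi p ^+ 3)^-1.

Lemma meridianE p : ((meridian p 0 0 = - (p 0 0 * p 0 3 / b ^+ 2)) *
  (meridian p 0 1 = - (p 0 1 * p 0 3 / b ^+ 2)) * (meridian p 0 2 = - (p 0 2 * p 0 3 / b ^+ 2)) *
  (meridian p 0 3 = parallel_sq p / a ^+ 2))%type.
Proof. by rewrite !mxE. Qed.

Let a2 : a ^+ 2 != 0. Proof. by rewrite gt_eqF ?exprn_gt0. Qed.
Let b2 : b ^+ 2 != 0. Proof. by rewrite gt_eqF ?exprn_gt0. Qed.

Lemma ellipsoid_funE p : f p = parallel_sq p / a ^+ 2 + p 0 3 ^+ 2 / b ^+ 2.
Proof. by []. Qed.

Lemma ellipsoid_parallel_sq p : f p = 1 ->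
  parallel_sq p = a ^+ 2 * (1 - p 0 3 ^+ 2 / b ^+ 2).
Proof. by rewrite ellipsoid_funE => <-; field; rewrite gt_eqF // gt_eqF. Qed.

Lemma normal_length_sqE p : phi p ^+ 2 = parallel_sq p / a ^+ 4 + p 0 3 ^+ 2 / b ^+ 4.
Proof.
rewrite normal_length_sq dotE !conormalE /parallel_sq; field.
by rewrite !gt_eqF.
Qed.

Lemma parallel_sq_ge0 p : 0 <= parallel_sq p.
Proof. by rewrite /parallel_sq !addr_ge0 ?sqr_ge0. Qed.

Lemma parallel_sq_eq0 p : parallel_sq p = 0 -> [/\ p 0 0 = 0, p 0 1 = 0 & p 0 2 = 0].
Proof. by rewrite /parallel_sq => h; split; nra. Qed.

Lemma sub_tangent p v : (v <= tangent f p)%MS = (dot (nu p) v == 0).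
Proof.
have E : v *m (gradient f p)^T = (2 * dot (nu p) v)%:M.
  apply/rowP => i; rewrite ord1 gradient_ellipsoid_fun linearZ/= -scalemxAr mxE.
  rewrite -[X in _ * X]/(dot v (nu p)) !mxE eqxx mulr1n; congr (2 * _).
  by rewrite !dotE; ring.
apply/sub_kermxP/eqP => [|h]; last by rewrite E h mulr0 raddf0.
by rewrite E => /matrixP/(_ 0 0); rewrite !mxE mulr1n => /eqP; rewrite mulf_eq0 pnatr_eq0/= => /eqP.
Qed.

Lemma sub_horizontal p v :
  (v <= horizontal p)%MS = (dot (nu p) v == 0) && (v 0 3 == 0).
Proof.
rewrite -sub_tangent /tangent.
have E : v *m (delta_mx 0 3 : 'rV[R]_4)^T = (v 0 3)%:M.
  by apply/rowP => i; rewrite ord1 trmx_delta -colE !mxE mulr1n.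
apply/sub_kermxP/andP => [|[/sub_kermxP g0 /eqP h]]; rewrite mul_mx_row; last first.
  by rewrite g0 E h raddf0 row_mx0.
rewrite -[RHS]row_mx0 => /eq_row_mx[h1 h2]; split; first exact/sub_kermxP.
by move: h2; rewrite E => /matrixP/(_ 0 0); rewrite !mxE mulr1n => ->.
Qed.

Lemma meridian_tangent p : (meridian p <= tangent f p)%MS.
Proof.
rewrite sub_tangent dotE !conormalE !meridianE; apply/eqP.
by rewrite /parallel_sq; field; rewrite !gt_eqF.
Qed.

Lemma rank_tangent p : f p = 1 -> \rank (tangent f p) = 3%N.
Proof.
move=> fp; rewrite mxrank_ker mxrank_tr rank_rV gradient_ellipsoid_fun.
by rewrite scaler_eq0 pnatr_eq0/= conormal_neq0.
Qed.

(** The normal is vertical only on the w-axis. *)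
Lemma row_free_conormal p : parallel_sq p != 0 ->
  row_free (col_mx (gradient f p) (delta_mx 0 3 : 'rV[R]_4)).
Proof.
move=> s0; apply: inj_row_free => u; rewrite -[u]hsubmxK mul_row_col.
move: (lsubmx u) (rsubmx u) => {u} l r.
rewrite [l]mx11_scalar [r]mx11_scalar !mul_scalar_mx gradient_ellipsoid_fun scalerA => h.
have H i := congr1 (fun M : 'rV[R]_4 => M 0 i) h.
have l0 : l 0 0 = 0.
  apply/eqP/negPn/negP => l0; case/negP: s0; apply/eqP.
  have z x : l 0 0 * 2 * (x / a ^+ 2) + r 0 0 * 0 = 0 -> x = 0.
    move/eqP; rewrite mulr0 addr0 !mulf_eq0 (negbTE l0) pnatr_eq0/= invr_eq0 (negbTE a2) orbF.
    by move/eqP.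
  have := H 0; rewrite !mxE/= => /z x0.
  have := H 1; rewrite !mxE/= => /z x1.
  have := H 2; rewrite !mxE/= => /z x2.
  by rewrite /parallel_sq x0 x1 x2; ring.
have r0 : r 0 0 = 0.
  by have := H 3; rewrite !mxE/= l0 !mul0r add0r mulr1.
by rewrite l0 r0 !raddf0 row_mx0.
Qed.

Lemma rank_horizontal p : parallel_sq p != 0 -> \rank (horizontal p) = 2%N.
Proof.
move=> /row_free_conormal; rewrite mxrank_ker -tr_col_mx mxrank_tr.
by rewrite /row_free => /eqP ->.
Qed.

(** On a horizontal tangent vector [conormal] is multiplication by 1 / a^2, hence
    its value remains orthogonal to the normal. *)
Lemma horizontal_eigenspace p : f p = 1 ->
  (horizontal p <= eigenspace (weingarten f p) (parallel_curvature p))%MS.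
Proof.
move=> fp; apply/row_subP => i; have := row_sub i (horizontal p); move: (row i _) => v.
rewrite sub_horizontal => /andP[/eqP h /eqP v3].
have nv : nu v = (a ^+ 2)^-1 *: v.
  by apply: row4P; rewrite !conormalE !mxE ?v3; ring.
apply/eigenspaceP; rewrite mulmx_weingarten// nv.
have -> : dot (nu p) ((a ^+ 2)^-1 *: v) = (a ^+ 2)^-1 * dot (nu p) v.
  by rewrite !dotE !mxE; ring.
rewrite h mulr0 mul0r scale0r subr0 scalerA /parallel_curvature.
by congr (_ *: _); rewrite [RHS]invfM mulrC.
Qed.

Lemma meridian_eigenspace p : f p = 1 ->
  (meridian p <= eigenspace (weingarten f p) (meridian_curvature p))%MS.
Proof.
move=> fp; apply/eigenspaceP; rewrite mulmx_weingarten//.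
have phi0 := normal_length_gt0 fp.
have -> : (phi p)^-1 = (phi p ^+ 3)^-1 * (parallel_sq p / a ^+ 4 + p 0 3 ^+ 2 / b ^+ 4).
  by rewrite -normal_length_sqE; field; rewrite gt_eqF.
have -> : dot (nu p) (nu (meridian p)) =
    parallel_sq p * p 0 3 * (a ^+ 2 - b ^+ 2) / (a ^+ 4 * b ^+ 4).
  by rewrite dotE !conormalE !meridianE /parallel_sq; field; rewrite !gt_eqF.
rewrite /meridian_curvature.
by apply: row4P; rewrite !mxE/= !(ellipsoid_parallel_sq fp); field; rewrite !gt_eqF.
Qed.

(** The meridian direction is not horizontal, and the dimensions 2 + 1 = 3 agree. *)
Lemma tangent_decomposition p : f p = 1 -> parallel_sq p != 0 ->
  (horizontal p + <<meridian p>> :=: tangent f p)%MS /\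
  (horizontal p :&: <<meridian p>>)%MS = 0.
Proof.
move=> fp s0; have m3 : meridian p 0 3 != 0.
  by rewrite meridianE mulf_eq0 (negbTE s0) invr_eq0 a2.
have cap0 : (horizontal p :&: <<meridian p>>)%MS = 0.
  apply/eqP/rowV0P => v; rewrite sub_capmx genmxE sub_horizontal.
  move=> /andP[/andP[_ /eqP v3] /sub_rVP[c vE]].
  move: v3; rewrite vE mxE => /eqP; rewrite mulf_eq0 (negbTE m3) orbF => /eqP ->.
  by rewrite scale0r.
split=> //; apply/eqmxP.
have sub : (horizontal p + <<meridian p>> <= tangent f p)%MS.
  rewrite addsmx_sub genmxE meridian_tangent andbT; apply/row_subP => i.
  have := row_sub i (horizontal p); rewrite sub_horizontal => /andP[h _].
  by rewrite sub_tangent.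
rewrite sub -(geq_leqif (mxrank_leqif_sup sub)) rank_tangent// mxrank_disjoint_sum//.
rewrite rank_horizontal// genmxE rank_rV.
by have -> : meridian p != 0 by apply: contraNneq m3 => ->; rewrite mxE.
Qed.

(** On the ellipsoid b^2 phi^2 = 1 - parallel_sq p * (a^2 - b^2) / a^4, and the
    quotient of the two curvatures is b^2 phi^2. *)
Lemma curvature_gap p : f p = 1 -> meridian_curvature p =
  parallel_curvature p
    + parallel_sq p * (a ^+ 2 - b ^+ 2) / (a ^+ 6 * b ^+ 2 * phi p ^+ 3).
Proof.
move=> fp; have phi0 := normal_length_gt0 fp.
rewrite /parallel_curvature /meridian_curvature [(a ^+ 2 * phi p)^-1]invfM.
have -> : (phi p)^-1 = (phi p ^+ 3)^-1 * (parallel_sq p / a ^+ 4 + p 0 3 ^+ 2 / b ^+ 4).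
  by rewrite -normal_length_sqE; field; rewrite gt_eqF.
by rewrite !(ellipsoid_parallel_sq fp); field; rewrite !gt_eqF.
Qed.

Lemma char_poly_weingarten p : f p = 1 ->
  char_poly (restrictmx (tangent f p) (weingarten f p)) =
    ('X - (parallel_curvature p)%:P) ^+ 2 * ('X - (meridian_curvature p)%:P).
Proof.
move=> fp; have [s0|s0] := eqVneq (parallel_sq p) 0; last first.
  have [PQ PQ0] := tangent_decomposition fp s0.
  have QA : (<<meridian p>> <= eigenspace (weingarten f p) (meridian_curvature p))%MS.
    by rewrite genmxE; exact: meridian_eigenspace.
  rewrite (char_poly_two_eigenspaces PQ PQ0 (horizontal_eigenspace fp) QA).
  rewrite rank_horizontal// genmxE rank_rV.
  suff -> : meridian p != 0 by rewrite expr1.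
  apply/eqP => m0; move: PQ; rewrite m0 genmx0 => PQ.
  have := rank_tangent fp; rewrite -PQ addsmx0.
  by rewrite rank_horizontal.
have -> : meridian_curvature p = parallel_curvature p.
  by rewrite curvature_gap// s0 !mul0r addr0.
(* At a pole every tangent vector is horizontal. *)
have TA : (tangent f p <= eigenspace (weingarten f p) (parallel_curvature p))%MS.
  apply: submx_trans (horizontal_eigenspace fp); apply/row_subP => i.
  have := row_sub i (tangent f p); move: (row i _) => v.
  rewrite sub_tangent sub_horizontal => /[dup] vT ->/=.
  move: vT; have [p0 p1 p2] := parallel_sq_eq0 s0.
  rewrite dotE !conormalE p0 p1 p2 !mul0r !add0r !mulf_eq0 invr_eq0 (negbTE b2) orbF.
  move=> /orP[/eqP p3|//].
  by move: fp; rewrite ellipsoid_funE s0 p3 expr0n/= !mul0r addr0 => /eqP; rewrite eq_sym oner_eq0.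
rewrite (char_poly_two_eigenspaces (beta := 0) (addsmx0 _ _) (capmx0 _ _) TA (sub0mx _ _)).
rewrite rank_tangent// mxrank0 expr0 mulr1.
by rewrite -exprSr.
Qed.

(** The characteristic polynomial determines its roots up to a permutation, and
    there is only one way to sort them. *)
Lemma principal_curvatures_unique (g : 'rV[R]_4 -> R) p (k k' : 'I_3 -> R) :
  are_principal_curvatures g p k -> are_principal_curvatures g p k' -> k = k'.
Proof.
have sortedk (h : 'I_3 -> R) : {homo h : i j / (i <= j)%N >-> i <= j} ->
    sorted <=%R (codom h).
  move=> hh; rewrite codomE; apply: (homo_sorted (e := fun i j : 'I_3 => (i <= j)%N)) => //.
  by rewrite -(sorted_map (f := val)) val_enum_ord iota_sorted.
move=> [hk ck] [hk' ck'].
have := etrans (esym ck) ck'; rewrite -!(big_image _ _ _ _ (fun x => 'X - x%:P)) /=.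
move=> /prod_XsubC_eq E.
have : codom k = codom k'.
  apply: (sorted_eq le_trans le_anti) => //; exact: sortedk.
by rewrite !codomE => /eq_in_map H; apply/funext => i; apply: H; rewrite mem_enum.
Qed.

(** The rank of the meridian curvature in the sorted list: the sign of
    [curvature_gap] is that of a^2 - b^2. *)
Definition meridian_index : 'I_3 := if b < a then 2 else 0.

Hypothesis ab : a ^+ 2 != b ^+ 2.

Let ltab : (b ^+ 2 < a ^+ 2) = (b < a).
Proof. by rewrite ltr_pXn2r ?nnegrE ?ltW. Qed.

Lemma prod3E (V : pzSemiRingType) (F : 'I_3 -> V) : \prod_i F i = F 0 * F 1 * F 2.
Proof.
rewrite !big_ord_recl big_ord0 mulr1 !mulrA.
by do 2?congr (_ * _); congr F; apply: val_inj.
Qed.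

Lemma ord3P (P : 'I_3 -> Prop) : P 0 -> P 1 -> P 2 -> forall i, P i.
Proof.
move=> P0 P1 P2 [[|[|[|i]]] Hi] //.
- by rewrite (_ : Ordinal Hi = 0)//; exact: val_inj.
- by rewrite (_ : Ordinal Hi = 1)//; exact: val_inj.
- by rewrite (_ : Ordinal Hi = 2)//; exact: val_inj.
Qed.

Lemma curvature_gap_sign p : f p = 1 ->
  (parallel_curvature p <= meridian_curvature p) = (parallel_sq p == 0) || (b < a).
Proof.
move=> fp; have phi0 := normal_length_gt0 fp.
rewrite curvature_gap// lerDl mulrAC -ltab -subr_gt0.
set d := a ^+ 2 - b ^+ 2; have d0 : d != 0 by rewrite subr_eq0.
have den0 : 0 < (a ^+ 6 * b ^+ 2 * phi p ^+ 3)^-1.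
  by rewrite invr_gt0 !mulr_gt0// exprn_gt0.
have [->|s0] := eqVneq (parallel_sq p) 0; first by rewrite !mul0r lexx.
have sgt : 0 < parallel_sq p by rewrite lt_neqAle eq_sym s0 parallel_sq_ge0.
by rewrite pmulr_rge0 ?mulr_gt0// le_eqVlt eq_sym (negbTE d0).
Qed.

Lemma curvatures_neq p : f p = 1 ->
  (parallel_curvature p != meridian_curvature p) = (parallel_sq p != 0).
Proof.
move=> fp; have phi0 := normal_length_gt0 fp.
rewrite curvature_gap// eq_sym -subr_eq0 addrAC subrr add0r.
have den0 : 0 < a ^+ 6 * b ^+ 2 * phi p ^+ 3 by rewrite !mulr_gt0// exprn_gt0.
by rewrite mulf_eq0 invr_eq0 (gt_eqF den0) orbF mulf_eq0 subr_eq0 (negbTE ab) orbF.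
Qed.

(** The formula also holds at the poles, where both curvatures agree. *)
Lemma principal_curvatureE p : f p = 1 -> principal_curvature f p =
  fun i => if i == meridian_index then meridian_curvature p else parallel_curvature p.
Proof.
move=> fp; set k := (X in _ = X).
suff kP : are_principal_curvatures f p k.
  by apply: xget_unique => // k' /principal_curvatures_unique; apply.
have gap := curvature_gap_sign fp; have neq := curvatures_neq fp.
rewrite /k /meridian_index; split; last first.
  rewrite char_poly_weingarten// prod3E.
  by case: (b < a) => /=; [rewrite expr2|rewrite expr2 mulrC mulrA].
case: (b < a) gap; rewrite ?orbT ?orbF => gap.
  by apply: ord3P; apply: ord3P => //= _; rewrite gap.
have {}gap : meridian_curvature p <= parallel_curvature p.
  have [//|lt] := leP (meridian_curvature p) (parallel_curvature p).
  have := ltW lt; rewrite gap => s0.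
  by move: lt; rewrite lt_neqAle neq s0.
by apply: ord3P; apply: ord3P => //= _; exact: gap.
Qed.

Lemma meridian_index_neq1 : (1 == meridian_index) = false.
Proof. by rewrite /meridian_index; case: (b < a). Qed.

Lemma umbilicP p : umbilic_set f p <-> f p = 1 /\ parallel_sq p = 0.
Proof.
rewrite /umbilic_set /hypersurface /=; split=> -[fp];
  have neq := curvatures_neq fp; rewrite (principal_curvatureE fp) /=.
  rewrite /meridian_index; case: (b < a) => /= -[h1 h2]; split => //; apply/eqP.
    by rewrite -[_ == _]negbK -neq h2 eqxx.
  by rewrite -[_ == _]negbK -neq h1 eqxx.
move=> s0; have -> : meridian_curvature p = parallel_curvature p.
  by apply/eqP; rewrite eq_sym -[_ == _]negbK neq s0 eqxx.
by split => //; rewrite !if_same.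
Qed.

Lemma partially_umbilicP p : partially_umbilic_set f p <-> f p = 1 /\ parallel_sq p != 0.
Proof.
rewrite /partially_umbilic_set /hypersurface /=; split=> -[fp];
  have neq := curvatures_neq fp; rewrite (principal_curvatureE fp) /= -neq.
  rewrite /meridian_index; case: (b < a) => /= -[] [h1 h2]; split => //.
  - by move: h1; rewrite eqxx.
  - by move: h2; rewrite eqxx.
  - by rewrite eq_sym.
move=> s0; split=> //; rewrite /meridian_index; case: (b < a) => /=; [left|right] => //.
by rewrite eq_sym.
Qed.

Lemma principal_domainP p :
  principal_domain f meridian_index p <-> f p = 1 /\ parallel_sq p != 0.
Proof.
rewrite /principal_domain /hypersurface /=; split=> -[fp];
  have neq := curvatures_neq fp; rewrite (principal_curvatureE fp) /= -neq.
  move=> /(_ 1); rewrite meridian_index_neq1/= eqxx => h.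
  by split => //; apply: h.
by move=> s0; split=> // j jm; rewrite (negbTE jm) eqxx.
Qed.

Lemma principal_space_meridian p : f p = 1 -> parallel_sq p != 0 ->
  (principal_space f p meridian_index :=: meridian p)%MS.
Proof.
move=> fp s0; have [PQ PQ0] := tangent_decomposition fp s0.
rewrite /principal_space principal_curvatureE// eqxx.
apply: eqmx_trans (genmxE _).
apply: eigenspace_cap_second PQ (horizontal_eigenspace fp) _ _.
  by rewrite genmxE; exact: meridian_eigenspace.
by rewrite curvatures_neq.
Qed.

Lemma partially_umbilic_plane_horizontal p : f p = 1 -> parallel_sq p != 0 ->
  (partially_umbilic_plane f p :=: horizontal p)%MS.
Proof.
move=> fp s0; have [PQ PQ0] := tangent_decomposition fp s0.
rewrite /partially_umbilic_plane /principal_space principal_curvatureE// meridian_index_neq1.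
apply: eigenspace_cap_first PQ (horizontal_eigenspace fp) _ _.
  by rewrite genmxE; exact: meridian_eigenspace.
by rewrite curvatures_neq.
Qed.

Lemma poleP p : poles b p <-> f p = 1 /\ parallel_sq p = 0.
Proof.
have pole c : c ^+ 2 = b ^+ 2 -> f (on_w_axis c) = 1 /\ parallel_sq (on_w_axis c) = 0.
  move=> cb; have s0 : parallel_sq (on_w_axis c) = 0 by rewrite /parallel_sq !mxE/=; ring.
  by split=> //; rewrite ellipsoid_funE s0 mul0r add0r !mxE/= mulr1 cb divff.
split=> [[->|->]|[fp s0]]; [exact: pole|by apply: pole; rewrite sqrrN|].
have [p0 p1 p2] := parallel_sq_eq0 s0.
have : p 0 3 ^+ 2 = b ^+ 2.
  by move: fp; rewrite ellipsoid_funE s0 mul0r add0r => /divr1_eq.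
move/eqP; rewrite eqf_sqr => /orP[] /eqP p3; [left|right];
  by apply: row4P; rewrite !mxE/= ?p0 ?p1 ?p2 ?p3; ring.
Qed.

End Curvatures.

(** * The foliation by level spheres *)

Lemma polar_coordinates (R : realType) (x y : R) :
  exists t, x = Num.sqrt (x ^+ 2 + y ^+ 2) * cos t /\ y = Num.sqrt (x ^+ 2 + y ^+ 2) * sin t.
Proof.
set r := Num.sqrt _.
have r2 : r ^+ 2 = x ^+ 2 + y ^+ 2 by rewrite sqr_sqrtr// addr_ge0// sqr_ge0.
have rge0 : 0 <= r by exact: sqrtr_ge0.
have [r0|r0] := eqVneq r 0.
  by exists 0; rewrite r0 !mul0r; move: r2; rewrite r0; split; nra.
have rgt0 : 0 < r by rewrite lt_neqAle eq_sym r0.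
have xr : -1 <= x / r <= 1 by rewrite ler_pdivlMr// ler_pdivrMr//; apply/andP; split; nra.
have sE : Num.sqrt (1 - (x / r) ^+ 2) = `|y| / r.
  rewrite -[RHS]ger0_norm ?divr_ge0// -sqrtr_sqr; congr Num.sqrt.
  rewrite !expr_div_n real_normK ?num_real// -[LHS](mulfK (expf_neq0 2 r0)).
  by congr (_ / _); rewrite r2; field; rewrite -r2 expf_neq0.
have [y0|y0] := leP 0 y.
  exists (acos (x / r)); rewrite acosK// sin_acos// sE ger0_norm//.
  by split; field.
exists (- acos (x / r)); rewrite cosN sinN acosK// sin_acos// sE ltr0_norm//.
by split; field.
Qed.

Section LevelSpheres.
Context {R : realType} (a b : R).
Hypotheses (a0 : 0 < a) (b0 : 0 < b) (ab : a ^+ 2 != b ^+ 2).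
Implicit Types p q u v : 'rV[R]_4.
Local Notation f := (ellipsoid_fun a b).

Lemma level_setP c p : level_set a b c p <->
  p 0 3 = c /\ parallel_sq p = a ^+ 2 * (1 - c ^+ 2 / b ^+ 2).
Proof.
split=> [[/= fp <-]|[<- s]]; first by rewrite (ellipsoid_parallel_sq a0 b0 fp).
split=> //; rewrite /ellipsoid /hypersurface /= ellipsoid_funE s.
by field; rewrite !gt_eqF.
Qed.

Lemma level_radius_gt0 c : (0 < a ^+ 2 * (1 - c ^+ 2 / b ^+ 2)) = (- b < c < b).
Proof.
rewrite pmulr_rgt0 ?exprn_gt0// subr_gt0 ltr_pdivrMr ?exprn_gt0// mul1r.
by rewrite -ltr_norml -[c ^+ 2]real_normK ?num_real// ltr_pXn2r ?nnegrE// ltW.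
Qed.

Lemma level_set_is_sphere c : - b < c < b -> is_sphere c (level_set a b c).
Proof.
rewrite -level_radius_gt0; set d := a ^+ 2 * _ => d0.
exists (Num.sqrt d); first by rewrite sqrtr_gt0.
have E p : p 0 3 = c -> dot (p - on_w_axis c) (p - on_w_axis c) = parallel_sq p.
  by move=> pc; rewrite dotE !mxE pc /parallel_sq /=; ring.
apply/seteqP; split=> [p /level_setP[pc s]|p [/= pc]].
  by split=> //; rewrite /enorm E// s.
rewrite /enorm E// => /(congr1 (fun x => x ^+ 2)); rewrite !sqr_sqrtr ?parallel_sq_ge0 ?ltW// => s.
exact/level_setP.
Qed.

(** The great circle of longitude [t] on the sphere of radius [r] in the space w = c.
    All of them pass through (r, 0, 0, c), at [s = 0], and they cover the sphere:
    it is therefore connected. *)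
Definition great_circle (c r t s : R) : 'rV[R]_4 :=
  \row_i [:: r * cos s; r * (sin s * cos t); r * (sin s * sin t); c]`_i.

Lemma continuous_great_circle c r t : continuous (great_circle c r t).
Proof.
move=> s; apply: differentiable_continuous; apply: differentiable_row => i.
apply/derivable1_diffP; move: i; apply: ord4P; under eq_fun do rewrite mxE /=;
  exact: ex_derive.
Qed.

Lemma level_set_connected c : - b < c < b -> connected (level_set a b c).
Proof.
rewrite -level_radius_gt0; set d := a ^+ 2 * _ => d0; pose r := Num.sqrt d.
have r2 : r ^+ 2 = d by rewrite sqr_sqrtr// ltW.
have -> : level_set a b c = \bigcup_t (great_circle c r t @` setT).
  apply/seteqP; split=> p.
    move=> /level_setP[pc]; rewrite -/d => s.
    (* Spherical coordinates: polar coordinates of (y, z), then of x and the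
       resulting radius. *)
    have [t [p1 p2]] := polar_coordinates (p 0 1) (p 0 2).
    have [s' [p0 rho]] := polar_coordinates (p 0 0) (Num.sqrt (p 0 1 ^+ 2 + p 0 2 ^+ 2)).
    have rE : Num.sqrt (p 0 0 ^+ 2 + Num.sqrt (p 0 1 ^+ 2 + p 0 2 ^+ 2) ^+ 2) = r.
      by rewrite [X in _ + X]sqr_sqrtr ?addr_ge0 ?sqr_ge0// addrA -/(parallel_sq p) s.
    exists t => //; exists s' => //; apply: row4P; rewrite !mxE /= -?pc//.
    + by rewrite [RHS]p0 rE.
    + by rewrite [RHS]p1 rho rE mulrA.
    + by rewrite [RHS]p2 rho rE mulrA.
  move=> [t _ [s _ <-]]; apply/level_setP; rewrite -/d -r2 /parallel_sq !mxE /=; split=> //.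
  transitivity (r ^+ 2 * (cos s ^+ 2 + sin s ^+ 2 * (cos t ^+ 2 + sin t ^+ 2))); first by ring.
  by rewrite cos2Dsin2 mulr1 cos2Dsin2 mulr1.
apply: bigcup_connected.
  exists (great_circle c r 0 0) => t _; exists 0 => //.
  by apply: row4P; rewrite !mxE//= sin0 !mul0r.
move=> t _; apply: connected_continuous_connected.
  by apply/connected_intervalP.
exact/continuous_subspaceT/continuous_great_circle.
Qed.

(** The level set at height [c] is the zero set of this map.  Its Jacobian has the
    columns that define [horizontal]. *)
Definition level_equation c q : 'rV[R]_2 :=
  \row_j (if j == 0 then f q - 1 else q 0 3 - c).

Lemma polynomial_level_equation c i : polynomial_fun (fun q => level_equation c q 0 i).
Proof.
under eq_fun do rewrite mxE; case: (i == 0); apply: polynomial_add.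
- exact: polynomial_ellipsoid_fun.
- exact: polynomial_cst.
- exact: polynomial_coord.
- exact: polynomial_cst.
Qed.

Lemma is_derive_level_equation c q v :
  is_derive q v (level_equation c) (\row_j (if j == 0 then 2 * dot (conormal a b q) v else v 0 3)).
Proof.
have dcst (k : R) : is_derive q v (fun=> k) 0 by exact: is_derive_cst.
have df := is_deriveB (is_derive_ellipsoid_fun a b q v) (dcst 1).
have dw := is_deriveB (is_derive_coord q v 3) (dcst c).
apply: is_derive_row => j; have [j0|j0] := boolP (j == 0).
  by apply: (is_derive_ext df) => [x|]; rewrite mxE j0 ?subr0.
by apply: (is_derive_ext dw) => [x|]; rewrite mxE (negbTE j0) ?subr0.
Qed.

Lemma kermx_level_equation c q :
  (kermx ('J (level_equation c) q) :=: horizontal a b q)%MS.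
Proof.
apply/eqmxP.
suff H v : (v <= kermx ('J (level_equation c) q))%MS = (v <= horizontal a b q)%MS.
  by apply/andP; split; apply/rV_subP => v; rewrite H.
have dh : differentiable (level_equation c) q.
  by apply: differentiable_row => i; exact/polynomial_differentiable/polynomial_level_equation.
rewrite sub_horizontal; apply/sub_kermxP/andP; rewrite mulmx_jacobian//;
  have [_ ->] := is_derive_level_equation c q v.
- move=> h; have := congr1 (fun M : 'rV_2 => M 0 0) h; have := congr1 (fun M : 'rV_2 => M 0 1) h.
  by rewrite !mxE /= => -> /eqP; rewrite mulf_eq0 pnatr_eq0.
- move=> [/eqP d /eqP v3]; apply/rowP => j; rewrite !mxE d v3 mulr0.
  by case: ifP.
Qed.

Lemma level_set_integral_surface c : - b < c < b ->
  integral_surface (partially_umbilic_plane f) (level_set a b c).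
Proof.
rewrite -level_radius_gt0 => d0 p Sp.
exists setT, (level_equation c); split=> //.
- exact: openT.
- apply: polynomial_smooth; exact: polynomial_level_equation.
- move=> q _; split=> [[fq]|h].
    rewrite /= /proj_w => qc; rewrite /ellipsoid /hypersurface /= in fq.
    by apply/rowP => j; rewrite !mxE fq qc !subrr; case: ifP.
  have := congr1 (fun M : 'rV_2 => M 0 0) h; have := congr1 (fun M : 'rV_2 => M 0 1) h.
  by rewrite !mxE /= => /eqP; rewrite subr_eq0 => /eqP ? /eqP; rewrite subr_eq0 => /eqP.
- move=> q _ Sq; have K := kermx_level_equation c q.
  have fq : f q = 1 by case: Sq.
  have s0 : parallel_sq q != 0 by have [_ ->] := (level_setP c q).1 Sq; rewrite gt_eqF.
  split.
    have := rank_horizontal b a0 s0; rewrite -K mxrank_ker => h.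
    have := rank_leq_row ('J (level_equation c) q).
    by move: h; case: (\rank _) => [|[|[|[|[|?]]]]].
  apply/eqmxP; apply: eqmx_trans K _; apply: eqmx_sym.
  exact: partially_umbilic_plane_horizontal.
Qed.

Lemma level_set_foliation :
  integral_foliation (partially_umbilic_set f) (partially_umbilic_plane f)
    [set level_set a b c | c in [set c | - b < c < b]].
Proof.
split; last first.
  move=> S [c cb <-].
  by split; [exact: level_set_connected|exact: level_set_integral_surface].
split.
- apply/seteqP; split=> p.
    move=> [S [c /= cb <-] Sp]; apply/(partially_umbilicP a0 b0 ab).
    have [fp _] := Sp; split => //.
    by have [_ ->] := (level_setP c p).1 Sp; rewrite gt_eqF// level_radius_gt0.
  move=> /(partially_umbilicP a0 b0 ab)[fp s0]; exists (level_set a b (p 0 3)) => //.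
  exists (p 0 3) => //=; rewrite -level_radius_gt0 -(ellipsoid_parallel_sq a0 b0 fp).
  by rewrite lt_neqAle eq_sym s0 parallel_sq_ge0.
- move=> S T [c _ <-] [d _ <-] [p [/level_setP[pc _] /level_setP[pd _]]].
  by rewrite -pc pd.
- move=> S [c /= cb <-]; exists (great_circle c (Num.sqrt (a ^+ 2 * (1 - c ^+ 2 / b ^+ 2))) 0 0).
  apply/level_setP; rewrite /parallel_sq !mxE /= sin0 cos0; split=> //.
  rewrite !mul0r !mulr0 mulr1 sqr_sqrtr; first by rewrite expr0n/= !addr0.
  by rewrite ltW// level_radius_gt0.
Qed.

End LevelSpheres.

(** * Hyperbolic functions *)

Section Hyperbolic.
Context {R : realType}.
Implicit Types s t w : R.

Definition cosh s : R := (expR s + expR (- s)) / 2.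
Definition sinh s : R := (expR s - expR (- s)) / 2.
Definition tanh s : R := sinh s / cosh s.
Definition artanh w : R := (ln (1 + w) - ln (1 - w)) / 2.

Lemma cosh_gt0 s : 0 < cosh s.
Proof. by rewrite divr_gt0// addr_gt0// expR_gt0. Qed.

Lemma cosh_neq0 s : cosh s != 0.
Proof. by rewrite gt_eqF// cosh_gt0. Qed.

Lemma cosh_sq s : cosh s ^+ 2 = 1 + sinh s ^+ 2.
Proof.
rewrite /cosh /sinh expRN; have := lt0r_neq0 (expR_gt0 s); move: (expR s) => e e0.
by field.
Qed.

Lemma tanh_sq s : tanh s ^+ 2 = 1 - (cosh s ^+ 2)^-1.
Proof.
rewrite /tanh expr_div_n -[1](divff (expf_neq0 2 (cosh_neq0 s))) {2}cosh_sq.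
by field; rewrite cosh_neq0.
Qed.

Lemma tanh_lt1 s : `|tanh s| < 1.
Proof.
rewrite -(ltr_pXn2r (n := 2)) ?nnegrE// expr1n real_normK ?num_real// tanh_sq.
by rewrite gtrBl invr_gt0 exprn_gt0// cosh_gt0.
Qed.

Lemma tanh0 : tanh 0 = 0.
Proof. by rewrite /tanh /sinh oppr0 subrr !mul0r. Qed.

Lemma is_derive_expRN s : is_derive s (1 : R) (fun x => expR (- x)) (- expR (- s)).
Proof.
have d := is_derive1_comp (is_derive_expR (- s)) (is_deriveNid s 1).
by apply: (is_derive_ext d) => //; rewrite mulrN1.
Qed.

Lemma is_derive_cosh s : is_derive s (1 : R) cosh (sinh s).
Proof.
apply: (is_derive_ext (is_deriveZ 2^-1 (is_deriveD (is_derive_expR s) (is_derive_expRN s)))).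
  by move=> x; rewrite /cosh [RHS]mulrC.
by rewrite /sinh [RHS]mulrC.
Qed.

Lemma is_derive_sinh s : is_derive s (1 : R) sinh (cosh s).
Proof.
apply: (is_derive_ext (is_deriveZ 2^-1 (is_deriveB (is_derive_expR s) (is_derive_expRN s)))).
  by move=> x; rewrite /sinh [RHS]mulrC.
by rewrite opprK /cosh [RHS]mulrC.
Qed.

Lemma is_derive_sech s : is_derive s (1 : R) (fun x => (cosh x)^-1) (- (tanh s / cosh s)).
Proof.
apply: (is_derive_ext (is_derive_inv (cosh_neq0 s) (is_derive_cosh s))) => //.
by rewrite /tanh; field; rewrite cosh_neq0.
Qed.

Lemma is_derive_tanh s : is_derive s (1 : R) tanh ((cosh s ^+ 2)^-1).
Proof.
apply: (is_derive_ext (is_deriveM (is_derive_sinh s) (is_derive_sech s))) => //.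
transitivity (1 - tanh s ^+ 2); last by rewrite tanh_sq; ring.
by rewrite /tanh /GRing.scale /=; field; rewrite cosh_neq0.
Qed.

Lemma artanhK w : -1 < w < 1 -> tanh (artanh w) = w.
Proof.
move=> /andP[w1 w2]; have p1 : 0 < 1 + w by lra.
have p2 : 0 < 1 - w by lra.
have E : expR (artanh w) ^+ 2 = (1 + w) / (1 - w).
  by rewrite expr2 -expRD -splitr -ln_div// lnK// posrE divr_gt0.
have e0 := lt0r_neq0 (expR_gt0 (artanh w)).
rewrite /tanh /sinh /cosh expRN; move: (expR _) E e0 => e E e0.
have -> : (e - e^-1) / 2 / ((e + e^-1) / 2) = (e ^+ 2 - 1) / (e ^+ 2 + 1).
  by field; rewrite e0 gt_eqF// addr_gt0// exprn_even_gt0.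
by rewrite E; field; rewrite gt_eqF//; lra.
Qed.

Lemma is_derive_artanh w : -1 < w < 1 -> is_derive w (1 : R) artanh ((1 - w ^+ 2)^-1).
Proof.
move=> /andP[w1 w2]; have p1 : 0 < 1 + w by lra.
have p2 : 0 < 1 - w by lra.
have dc : is_derive w (1 : R) (fun=> 1 : R) 0 by exact: is_derive_cst.
have di : is_derive w (1 : R) (id : R -> R) 1 by exact: is_derive_id.
have d1 : is_derive w (1 : R) (fun x => 1 + x) 1.
  by apply: (is_derive_ext (is_deriveD dc di)) => //; rewrite add0r.
have d2 : is_derive w (1 : R) (fun x => 1 - x) (- 1).
  by apply: (is_derive_ext (is_deriveB dc di)) => //; rewrite add0r.
have e1 := is_derive1_comp (is_derive1_ln p1) d1.
have e2 := @is_derive1_comp R (@ln R) (fun x => 1 - x) w _ _ (is_derive1_ln p2) d2.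
apply: (is_derive_ext (is_deriveZ 2^-1 (is_deriveB e1 e2))) => [x|].
  by rewrite /artanh [RHS]mulrC.
rewrite /GRing.scale /=; field.
by rewrite !gt_eqF// !subr_gt0; nra.
Qed.

Lemma tanh_eq0 s : tanh s = 0 -> s = 0.
Proof.
move/eqP; rewrite mulf_eq0 invr_eq0 (negbTE (cosh_neq0 s)) orbF.
rewrite mulf_eq0 invr_eq0 pnatr_eq0 orbF subr_eq0 => /eqP /expR_inj.
by move=> h; lra.
Qed.

End Hyperbolic.

(** * Functions on an interval, and the time of the gradient flow *)

Lemma derive_eq0_cst (R : realType) (J : set R) (h : R -> R) :
  is_interval J -> (forall t, J t -> is_derive t (1 : R) h 0) ->
  forall x y, J x -> J y -> h x = h y.
Proof.
move=> iJ dh; suff H x y : J x -> J y -> x <= y -> h y = h x.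
  by move=> x y Jx Jy; have [xy|/ltW yx] := leP x y; [rewrite (H x y)|rewrite (H y x)].
move=> Jx Jy xy.
have Jxy t : t \in `[x, y] -> J t by rewrite in_itv /= => ?; exact: iJ Jx Jy _ _.
have [|c _] := @MVT_segment R h (fun=> 0) x y xy (fun t xyt => dh t (Jxy t (subset_itv_oo_cc xyt))).
  by apply: derivable_within_continuous => t /Jxy /dh[].
by rewrite mul0r => /eqP; rewrite subr_eq0 => /eqP.
Qed.

(** For c = b and d = a^2 / b, the flow of the gradient of w along the meridian
    s |-> (a u / cosh s, b tanh s) obeys s' = 1 / time_map'(s).  So [time_map] is
    the time that the flow takes from s = 0, and its inverse is a solution defined
    for all times. *)
Section TimeMap.
Context {R : realType} (c d : R).
Hypotheses (c0 : 0 < c) (d0 : 0 < d).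

Definition time_map s : R := (c - d) * tanh s + d * s.

Lemma is_derive_time_map s :
  is_derive s (1 : R) time_map (c * (cosh s ^+ 2)^-1 + d * tanh s ^+ 2).
Proof.
have dt := is_deriveZ (c - d) (is_derive_tanh s).
apply: (is_derive_ext (is_deriveD dt (is_deriveZ d (is_derive_id s (1 : R))))) => //.
by rewrite tanh_sq /GRing.scale /=; ring.
Qed.

Lemma time_map_derive_gt0 s : 0 < c * (cosh s ^+ 2)^-1 + d * tanh s ^+ 2.
Proof.
apply: ltr_wpDr; first by rewrite mulr_ge0 ?sqr_ge0// ltW.
by rewrite mulr_gt0// invr_gt0 exprn_gt0// cosh_gt0.
Qed.

Lemma time_map_inj : injective time_map.
Proof.
suff H x y : x < y -> time_map x < time_map y.
  move=> x y e; have [/H|/H|//] := ltgtP x y; by rewrite e ltxx.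
move=> xy.
have [|t _ e] := @MVT _ _ _ x y xy (fun t _ => is_derive_time_map t).
  by apply: derivable_within_continuous => t _; have [] := is_derive_time_map t.
by rewrite -subr_gt0 e mulr_gt0 ?subr_gt0// time_map_derive_gt0.
Qed.

Lemma time_map_surj t : exists s, time_map s = t.
Proof.
(* As |tanh| < 1, time_map differs from s |-> d s by at most |c - d|. *)
pose M := (`|t| + `|c - d|) / d.
have M0 : 0 <= M by rewrite divr_ge0 ?addr_ge0// ltW.
have dM : d * M = `|t| + `|c - d| by rewrite mulrC divfK// gt_eqF.
have bound s : `|(c - d) * tanh s| <= `|c - d|.
  by rewrite normrM ler_piMr// ltW// tanh_lt1.
have lo : time_map (- M) <= t.
  rewrite /time_map mulrN dM.
  by have := bound (- M); have := ler_norm (- t); rewrite normrN ler_norml => ? /andP[]; lra.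
have hi : t <= time_map M.
  rewrite /time_map dM.
  by have := bound M; have := ler_norm t; rewrite ler_norml => ? /andP[]; lra.
have [|||s _ <-] := @IVT _ time_map (- M) M t.
- by lra.
- by apply: derivable_within_continuous => x _; have [] := is_derive_time_map x.
- by rewrite ge_min lo/= le_max hi orbT.
by exists s.
Qed.

Lemma time_map_inverse : exists S : R -> R, cancel time_map S /\
  forall t, is_derive t (1 : R) S (c * (cosh (S t) ^+ 2)^-1 + d * tanh (S t) ^+ 2)^-1.
Proof.
have [S SK] := choice time_map_surj.
have KS : cancel time_map S by move=> s; apply: time_map_inj; rewrite SK.
exists S; split=> // t.
have n0 := lt0r_neq0 (time_map_derive_gt0 (S t)).
rewrite -[X in is_derive X](SK t); apply: (@is_derive_inverse R time_map S _ _ _ _ _ n0).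
- by near=> x; exact: KS.
- near=> x; apply: differentiable_continuous; apply/derivable1_diffP.
  by have [] := is_derive_time_map x.
- exact: is_derive_time_map.
Unshelve. all: by end_near. Qed.

End TimeMap.

(** * Lines of curvature and gradient lines *)

Section MeridianCurves.
Context {R : realType} (a b : R).
Hypotheses (a0 : 0 < a) (b0 : 0 < b) (ab : a ^+ 2 != b ^+ 2).
Implicit Types (p q u v : 'rV[R]_4) (J : set R) (g : R -> 'rV[R]_4).
Local Notation f := (ellipsoid_fun a b).
Local Notation phi := (normal_length a b).
Local Notation e := (meridian a b).
Local Notation U := [set p | f p = 1 /\ parallel_sq p != 0].

Let a2 : a ^+ 2 != 0. Proof. by rewrite gt_eqF ?exprn_gt0. Qed.
Let b2 : b ^+ 2 != 0. Proof. by rewrite gt_eqF ?exprn_gt0. Qed.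

Lemma surface_gradientE p : f p = 1 -> parallel_sq p != 0 ->
  surface_gradient f proj_w p = (a ^+ 2 * phi p ^+ 2)^-1 *: e p.
Proof.
move=> fp s0; have phi0 := normal_length_gt0 fp; set X := _ *: _.
have XT : (X <= tangent f p)%MS by rewrite scalemx_sub// meridian_tangent.
have dw v : 'd proj_w p v = v 0 3.
  rewrite -deriveE; last exact: differentiable_coord.
  by have [_ ->] := is_derive_coord p v 3.
have dotX v : (v <= tangent f p)%MS -> dot X v = v 0 3.
  rewrite sub_tangent => /eqP h.
  have -> : dot X v = (a ^+ 2 * phi p ^+ 2)^-1 * dot (e p) v.
    by rewrite !dotE /X !mxE /=; ring.
  (* The vector e is the sum of a vertical vector, of length (a phi)^2, and of a
     multiple of the normal. *)
  have -> : dot (e p) v = a ^+ 2 * phi p ^+ 2 * v 0 3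
      - a ^+ 2 * (p 0 3 / b ^+ 2) * dot (conormal a b p) v.
    rewrite normal_length_sqE// !dotE !conormalE !meridianE.
    by field; rewrite !gt_eqF.
  by rewrite h mulr0 subr0 mulKf// mulf_neq0// expf_neq0// gt_eqF.
apply: xget_unique => [|Y [YT dotY]].
  by split=> // v vT; rewrite dw dotX.
apply/eqP; rewrite -subr_eq0 -dotuu_eq0.
have DT : (Y - X <= tangent f p)%MS by rewrite addmx_sub// eqmx_opp.
have -> : dot (Y - X) (Y - X) = dot Y (Y - X) - dot X (Y - X) by rewrite !dotE !mxE; ring.
by rewrite dotY// dotX// dw subrr.
Qed.

(** Only the first three coordinates of [u] matter; the curve is on the ellipsoid
    when they form a unit vector. *)
Definition meridian_curve u (s : R) : 'rV[R]_4 :=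
  \row_i (if i == 3 then b * tanh s else a * u 0 i / cosh s).
Local Notation gamma := meridian_curve.

Lemma meridian_curve_parallel_sq u s :
  parallel_sq (gamma u s) = a ^+ 2 * parallel_sq u / cosh s ^+ 2.
Proof. by rewrite /parallel_sq !mxE /=; field; rewrite cosh_neq0. Qed.

Lemma meridian_curve_ellipsoid u s : parallel_sq u = 1 -> U (gamma u s).
Proof.
move=> u1; rewrite /= ellipsoid_funE meridian_curve_parallel_sq u1 mulr1; split; last first.
  by rewrite mulf_neq0// invr_eq0 expf_neq0// cosh_neq0.
rewrite !mxE /= [(b * _) ^+ 2]exprMn tanh_sq; field; rewrite !gt_eqF//.
exact: cosh_gt0.
Qed.

Lemma is_derive_meridian_curve u s : parallel_sq u = 1 ->
  is_derive s (1 : R) (gamma u) (b *: e (gamma u s)).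
Proof.
move=> u1; have E : parallel_sq (gamma u s) / a ^+ 2 = (cosh s ^+ 2)^-1.
  by rewrite meridian_curve_parallel_sq u1; field; rewrite cosh_neq0 gt_eqF.
apply: is_derive_row => i; have [i3|i3] := boolP (i == 3).
  apply: (is_derive_ext (is_deriveZ b (is_derive_tanh s))) => [x|].
    by rewrite mxE i3.
  by rewrite !mxE i3 E.
apply: (is_derive_ext (is_deriveZ (a * u 0 i) (is_derive_sech s))) => [x|].
  by rewrite mxE (negbTE i3).
rewrite !mxE (negbTE i3) /GRing.scale /=.
by field; rewrite cosh_neq0 gt_eqF.
Qed.

Lemma meridian_curve_normal_length u s : parallel_sq u = 1 ->
  b * (a ^+ 2 * phi (gamma u s) ^+ 2) = b * (cosh s ^+ 2)^-1 + a ^+ 2 / b * tanh s ^+ 2.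
Proof.
move=> u1; rewrite normal_length_sqE// meridian_curve_parallel_sq u1 !mxE /=.
by field; rewrite cosh_neq0 !gt_eqF.
Qed.

Lemma polynomial_meridian i : polynomial_fun (fun q => e q 0 i).
Proof.
under eq_fun do rewrite mxE; case: (i == 3).
  rewrite /parallel_sq.
  by do ?[apply: polynomial_add|apply: polynomial_mul|apply: polynomial_exp];
    first [exact: polynomial_coord|exact: polynomial_cst].
apply: polynomial_opp; apply: polynomial_mul; last exact: polynomial_cst.
by apply: polynomial_mul; exact: polynomial_coord.
Qed.

Lemma continuous_meridian : continuous e.
Proof.
move=> p; apply: differentiable_continuous; apply: differentiable_row => i.
exact/polynomial_differentiable/polynomial_meridian.
Qed.

Lemma continuous_derive1_meridian_curve u : parallel_sq u = 1 ->
  continuous (derive1 (gamma u)).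
Proof.
move=> u1 s; rewrite (_ : derive1 _ = fun s => b *: e (gamma u s)); last first.
  by apply/funext => x; rewrite derive1E; have [_ ->] := is_derive_meridian_curve x u1.
apply: cvgZr; apply: continuous_comp; last exact: continuous_meridian.
apply: differentiable_continuous; apply/derivable1_diffP.
by have [] := is_derive_meridian_curve s u1.
Qed.

Lemma meridian_neq0 p : parallel_sq p != 0 -> e p != 0.
Proof.
move=> s0; have : e p 0 3 != 0 by rewrite meridianE mulf_neq0// invr_eq0.
by apply: contraNneq => ->; rewrite mxE.
Qed.

Lemma open_interval_setT : open_interval (setT : set R).
Proof. by split=> //; [exact: openT|exists 0]. Qed.

Lemma meridian_line_field_curve L u :
  (forall p, U p -> (L p :=: e p)%MS) -> parallel_sq u = 1 ->
  line_field_curve U L setT (gamma u).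
Proof.
move=> LE u1; split=> [|s _]; first exact: open_interval_setT.
have Us := meridian_curve_ellipsoid s u1.
have [ds dE] := is_derive_meridian_curve s u1.
have dE1 : derive1 (gamma u) s = b *: e (gamma u s) by rewrite derive1E.
split; [exact: Us|exact: ds|exact: (continuous_derive1_meridian_curve u1)| |].
- by rewrite dE1 scaler_eq0 gt_eqF//= meridian_neq0//; exact: Us.2.
- by rewrite dE1 LE// scalemx_sub.
Qed.

(** [rapidity p] and [direction p] are the parameters [s] and [u] for which
    [meridian_curve u s] is [p]. *)
Definition rapidity p : R := artanh (p 0 3 / b).
Definition direction p : 'rV[R]_4 :=
  \row_i (if i == 3 then 0 else p 0 i * cosh (rapidity p) / a).

Lemma height_lt p : U p -> -1 < p 0 3 / b < 1.
Proof.
move=> [fp s0]; rewrite -ltr_norml -(ltr_pXn2r (n := 2)) ?nnegrE// expr1n real_normK ?num_real//.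
rewrite expr_div_n -subr_gt0; have := parallel_sq_ge0 p; rewrite le_eqVlt eq_sym (negbTE s0)/=.
by rewrite (ellipsoid_parallel_sq a0 b0 fp) pmulr_rgt0// exprn_gt0.
Qed.

Lemma tanh_rapidity p : U p -> tanh (rapidity p) = p 0 3 / b.
Proof. by move=> /height_lt; exact: artanhK. Qed.

Lemma cosh_rapidity p : U p -> (cosh (rapidity p) ^+ 2)^-1 = parallel_sq p / a ^+ 2.
Proof.
move=> Up; rewrite -[LHS](subKr 1) -tanh_sq tanh_rapidity//.
by rewrite (ellipsoid_parallel_sq a0 b0 Up.1); field; rewrite !gt_eqF.
Qed.

Lemma meridian_curveK p : U p -> gamma (direction p) (rapidity p) = p.
Proof.
move=> Up; have c0 := cosh_neq0 (rapidity p).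
apply: row4P; rewrite !mxE /= ?tanh_rapidity//; field; rewrite ?c0 ?gt_eqF//.
Qed.

Lemma direction_unit p : U p -> parallel_sq (direction p) = 1.
Proof.
move=> Up; have c0 := cosh_neq0 (rapidity p).
have -> : parallel_sq (direction p) = parallel_sq p / a ^+ 2 * cosh (rapidity p) ^+ 2.
  by rewrite /parallel_sq !mxE /=; field; rewrite gt_eqF.
by rewrite -cosh_rapidity// mulVf// expf_neq0.
Qed.

(** A curve tangent to the meridian field, with an arbitrary speed [lambda]: this
    covers both the lines of curvature and the gradient lines. *)
Section Tangency.
Variables (J : set R) (g : R -> 'rV[R]_4) (lambda : R -> R).
Hypotheses (iJ : is_interval J) (gU : forall t, J t -> U (g t))
  (dg : forall t, J t -> is_derive t (1 : R) g (lambda t *: e (g t))).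

Lemma is_derive_rapidity t : J t ->
  is_derive t (1 : R) (rapidity \o g) (lambda t / b).
Proof.
move=> Jt; have Ut := gU Jt; have hl := height_lt Ut.
have dw := is_deriveZ b^-1 (is_derive_row_coord 3 (dg Jt)).
have dw' : is_derive t (1 : R) (fun x => g x 0 3 / b) ((lambda t *: e (g t)) 0 3 / b).
  by apply: (is_derive_ext dw) => [x|]; rewrite mulrC.
apply: (is_derive_ext (@is_derive1_comp R (@artanh R) _ t _ _ (is_derive_artanh hl) dw')) => //.
have s0 : parallel_sq (g t) / a ^+ 2 != 0 by rewrite mulf_neq0 ?invr_eq0//; case: Ut.
have -> : 1 - (g t 0 3 / b) ^+ 2 = parallel_sq (g t) / a ^+ 2.
  by rewrite (ellipsoid_parallel_sq a0 b0 Ut.1); field; rewrite !gt_eqF.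
rewrite mxE meridianE; move: (parallel_sq (g t) / a ^+ 2) s0 => x x0.
by field; rewrite x0 gt_eqF.
Qed.

(** Along the curve, with s the rapidity, w = b tanh s and s' = lambda / b, while
    x' = - lambda w x / b^2 = - (tanh s) s' x.  Hence (x cosh s)' = 0. *)
Lemma direction_constant t t' : J t -> J t' -> direction (g t) = direction (g t').
Proof.
move=> Jt Jt'; apply/rowP => i; have [i3|i3] := boolP (i == 3); first by rewrite !mxE i3.
apply: (@derive_eq0_cst R J (fun t => direction (g t) 0 i) iJ _ _ _ Jt Jt') => {Jt'} {t'} {}t {}Jt.
have Ut := gU Jt.
have dc := @is_derive1_comp R (@cosh R) _ t _ _ (is_derive_cosh _) (is_derive_rapidity Jt).
have dx := is_derive_row_coord i (dg Jt).
apply: (is_derive_ext (is_deriveZ a^-1 (is_deriveM dx dc))) => [x|].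
  by rewrite mxE (negbTE i3) [RHS]mulrC.
have -> : sinh (rapidity (g t)) = cosh (rapidity (g t)) * (g t 0 3 / b).
  by rewrite -tanh_rapidity// /tanh mulrC divfK// cosh_neq0.
rewrite !mxE (negbTE i3) /GRing.scale /=.
by field; rewrite !gt_eqF.
Qed.

Lemma tangent_curve_in_meridian : J !=set0 ->
  exists u, parallel_sq u = 1 /\ forall t, J t -> g t = gamma u (rapidity (g t)).
Proof.
move=> [t0 Jt0]; exists (direction (g t0)); split; first exact/direction_unit/gU.
by move=> t Jt; rewrite (direction_constant Jt0 Jt) meridian_curveK//; exact: gU.
Qed.

End Tangency.

(** Meridians meet the hyperplane w = 0 in the single point [a u], which
    determines them. *)
Lemma meridian_range_eq u v : range (gamma u) `<=` range (gamma v) ->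
  range (gamma u) = range (gamma v).
Proof.
move=> /(_ (gamma u 0)) [|s _ sE]; first by exists 0.
have H i := congr1 (fun p : 'rV[R]_4 => p 0 i) sE.
have s0 : s = 0.
  apply: tanh_eq0; have := H 3; rewrite !mxE /= tanh0 mulr0 => /eqP.
  by rewrite mulf_eq0 gt_eqF//= => /eqP.
suff -> : gamma u = gamma v by [].
apply/funext => x; apply/rowP => i; have := H i; rewrite !mxE; case: (i == 3) => //.
rewrite s0 => /(mulIf _) h; have -> : a * u 0 i = a * v 0 i; last by [].
by symmetry; apply: h; rewrite invr_eq0 cosh_neq0.
Qed.

Lemma line_field_curve_in_meridian L J g :
  (forall p, U p -> (L p :=: e p)%MS) -> line_field_curve U L J g ->
  exists u, parallel_sq u = 1 /\ g @` J `<=` range (gamma u).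
Proof.
move=> LE [[oJ iJ J0] gL].
have lam t : exists l, J t -> derive1 g t = l *: e (g t).
  have [Jt|nJ] := pselect (J t); last by exists 0.
  have [Ut _ _ _] := gL t Jt; rewrite LE// => /sub_rVP[l lE].
  by exists l.
have [lambda lE] := choice lam.
have [||u [u1 gE]] := @tangent_curve_in_meridian J g lambda iJ _ _ J0.
- by move=> t /gL[].
- move=> t Jt; rewrite -(lE t Jt) derive1E; apply: derivableP.
  by have [_ dt _ _ _] := gL t Jt; exact: dt.
by exists u; split=> // _ [t Jt <-]; rewrite gE//; exists (rapidity (g t)).
Qed.

(** Every tangent curve is contained in a full meridian, which is itself the trace
    of a tangent curve; and no full meridian is properly contained in another. *)
Lemma line_field_leafP L C :
  (forall p, U p -> (L p :=: e p)%MS) ->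
  line_field_leaf U L C <-> exists u, parallel_sq u = 1 /\ C = range (gamma u).
Proof.
move=> LE; split=> [[[J [g [gJ ->]]] Cmax]|[u [u1 ->]]].
  have [u [u1 sub]] := line_field_curve_in_meridian LE gJ.
  by exists u; split=> //; apply: Cmax => //; exact: meridian_line_field_curve.
split; first by exists setT, (gamma u); split=> //; exact: meridian_line_field_curve.
move=> J g gJ sub; have [v [v1 sub']] := line_field_curve_in_meridian LE gJ.
apply/seteqP; split=> //.
by rewrite (meridian_range_eq (subset_trans sub sub')).
Qed.

(** Along a gradient line, [time_map] of the rapidity is the time up to a constant
    [k].  So the curve is a restriction of t |-> meridian_curve u (S (t + k)), where
    [S] is the inverse of [time_map]; this solution is defined on the whole line,
    and runs through the full meridian as [S] is onto. *)
Lemma gradient_curveP C :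
  (exists J g, maximal_integral_curve U (surface_gradient f proj_w) J g /\ C = g @` J) <->
  exists u, parallel_sq u = 1 /\ C = range (gamma u).
Proof.
have d0 : 0 < a ^+ 2 / b by rewrite divr_gt0// exprn_gt0.
have [S [KS dS]] := time_map_inverse b0 d0.
have flow u k : parallel_sq u = 1 ->
    integral_curve U (surface_gradient f proj_w) setT (fun t => gamma u (S (t + k))).
  move=> u1; split=> [|t _]; first exact: open_interval_setT.
  have [fs s0] := meridian_curve_ellipsoid (S (t + k)) u1; split=> //.
  rewrite surface_gradientE//.
  have dt : is_derive t (1 : R) (fun t => S (t + k))
      (b * (a ^+ 2 * phi (gamma u (S (t + k))) ^+ 2))^-1.
    rewrite meridian_curve_normal_length//.
    have dk : is_derive t (1 : R) (fun t : R => t + k) 1 by exact: is_derive_shift.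
    by apply: (is_derive_ext (@is_derive1_comp R S _ t _ _ (dS _) dk)) => //; rewrite mulr1.
  apply: is_derive_row => i.
  have dg := is_derive_row_coord i (is_derive_meridian_curve (S (t + k)) u1).
  apply: (is_derive_ext (@is_derive1_comp R _ _ t _ _ dg dt)) => //.
  rewrite [in LHS]mxE [in RHS]mxE.
  have phi0 := normal_length_gt0 fs.
  by field; rewrite !gt_eqF.
split=> [[J [g [[[[oJ iJ J0] gX] gmax] ->]]]|[u [u1 ->]]]; last first.
  exists setT, (fun t => gamma u (S (t + 0))); split.
    split; first exact: flow.
    by move=> J' g' _ sub _; apply/seteqP; split.
  apply/seteqP; split=> _ [s _ <-]; last by exists (S (s + 0)).
  by exists (time_map b (a ^+ 2 / b) s) => //; rewrite addr0 KS.
have gU t : J t -> U (g t) by move=> /gX[].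
have dg t : J t -> is_derive t (1 : R) g ((a ^+ 2 * phi (g t) ^+ 2)^-1 *: e (g t)).
  by move=> Jt; have [[ft s0]] := gX t Jt; rewrite surface_gradientE.
have [u [u1 gE]] := tangent_curve_in_meridian iJ gU dg J0.
have [t0 Jt0] := J0.
pose T t := time_map b (a ^+ 2 / b) (rapidity (g t)).
have dT t : J t -> is_derive t (1 : R) (fun t => T t - t) 0.
  move=> Jt; have [fs s0] := gU t Jt.
  have d1 := @is_derive1_comp R _ _ t _ _ (is_derive_time_map b (a ^+ 2 / b) _)
    (is_derive_rapidity gU dg Jt).
  have di : is_derive t (1 : R) (id : R -> R) 1 by exact: is_derive_id.
  apply: (is_derive_ext (is_deriveB d1 di)) => //.
  rewrite -(meridian_curve_normal_length _ u1) -gE//.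
  have phi0 := normal_length_gt0 fs.
  by field; rewrite !gt_eqF.
have TE t : J t -> rapidity (g t) = S (t + (T t0 - t0)).
  move=> Jt; rewrite -(derive_eq0_cst iJ dT Jt Jt0).
  by rewrite addrC subrK /T KS.
have JT : setT = J.
  apply: (gmax setT _ (flow u (T t0 - t0) u1)) => // t Jt.
  by rewrite [RHS]gE// TE.
exists u; split=> //; apply/seteqP; split=> [_ [t Jt <-]|_ [s _ <-]].
  by rewrite gE//; exists (rapidity (g t)).
exists (time_map b (a ^+ 2 / b) s - (T t0 - t0)); first by rewrite -JT.
by rewrite gE ?TE -?JT// subrK KS.
Qed.

End MeridianCurves.

(** * The umbilic set, the principal foliation and the level spheres *)

Theorem proposition1 (R : realType) (a b : R) :
  0 < a -> 0 < b -> a ^+ 2 != b ^+ 2 ->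
  let f := ellipsoid_fun a b in
  let E := ellipsoid a b in
  let U := E `\` poles b in
  [/\ umbilic_set f = poles b,
      partially_umbilic_set f = U /\ open (U : set (subspace E)),
      exists i : 'I_3,
        principal_foliation_regular f i U /\
        principal_foliation f i =
          [set C | exists (J : set R) (g : R -> 'rV[R]_4),
             maximal_integral_curve U (surface_gradient f proj_w) J g /\
             C = g @` J] &
      (forall c, - b < c < b -> is_sphere c (level_set a b c)) /\
      integral_foliation (partially_umbilic_set f) (partially_umbilic_plane f)
        [set level_set a b c | c in [set c | - b < c < b]]].
Proof.
move=> a0 b0 ab f E U.
have UE : U = [set p | f p = 1 /\ parallel_sq p != 0].
  apply/seteqP; split=> p [fp s0]; split=> //.
    by apply/eqP => s; apply: s0; apply/(poleP a b0).
  by move=> /(poleP a b0)[_ s]; rewrite s eqxx in s0.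
have domE : principal_domain f (meridian_index a b) = U.
  by rewrite UE; apply/seteqP; split=> p /(principal_domainP a0 b0 ab).
have LE p : [set p | f p = 1 /\ parallel_sq p != 0] p ->
    (principal_space f p (meridian_index a b) :=: meridian a b p)%MS.
  by case; exact: principal_space_meridian.
split.
- apply/seteqP; split=> p; first by move=> /(umbilicP a0 b0 ab)/(poleP a b0).
  by move=> /(poleP a b0)/(umbilicP a0 b0 ab).
- split; first by rewrite UE; apply/seteqP; split=> p /(partially_umbilicP a0 b0 ab).
  apply/open_subspaceP; exists (~` poles b).
    have cl p : closed [set p : 'rV[R]_4].
      exact/accessible_closed_set1/hausdorff_accessible/norm_hausdorff.
    by apply: closed_openC; exact: closedU.
  by rewrite /U setDE setIAC setIid setIC.
- exists (meridian_index a b); split.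
    split; first by rewrite domE.
    move=> p _; exists setT, (meridian a b); split=> //.
    + exact: openT.
    + exact/polynomial_smooth/polynomial_meridian.
    + move=> q _; rewrite UE => qU; split; first exact: (meridian_neq0 b a0 qU.2).
      exact/eqmxP/LE.
  rewrite /principal_foliation domE UE; apply/seteqP; split=> C /=.
    by move=> /(line_field_leafP a0 b0 _ LE) /(gradient_curveP a0 b0).
  by move=> /(gradient_curveP a0 b0) /(line_field_leafP a0 b0 _ LE).
- split; first by move=> c; exact: level_set_is_sphere.
  exact: level_set_foliation.
Qed.
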